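(* For every foliation $\mathcal{F}$ of degree $2$ on $\mathbb{P}^2_\mathbb{C}$ there exists a quadratic birational map $\psi$ of $\mathbb{P}^2_\mathbb{C}$ (i.e. a birational map of degree $2$) such that $\deg\psi^*\mathcal{F}\leq 3$.
   Context: A (singular holomorphic) foliation of degree $d$ on $\mathbb{P}^2_\mathbb{C}$ is given, in homogeneous coordinates $(x:y:z)$, by a $1$-form $\omega=A\,\mathrm{d}x+B\,\mathrm{d}y+C\,\mathrm{d}z$ with $A,B,C$ homogeneous polynomials of degree $d+1$ without common factor and $xA+yB+zC=0$; $\omega$ is unique up to a nonzero scalar. A birational map $\phi=(\phi_0:\phi_1:\phi_2)$ of $\mathbb{P}^2_\mathbb{C}$, with $\phi_i$ homogeneous of the same degree $k$ without common factor, has degree $k$. The foliation $\phi^*\mathcal{F}$ is the one defined by $\phi^*\omega$ after dividing its coefficients by their greatest common divisor. *)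

(* Defs.v *)
From HB Require Import structures.
From mathcomp Require Import all_boot all_order all_algebra.
From mathcomp Require Import reals.
From mathcomp Require Import complex mpoly.

Set Implicit Arguments.
Unset Strict Implicit.
Unset Printing Implicit Defensive.

Import GRing.Theory.
Local Open Scope ring_scope.

(* A triple (p_0, p_1, p_2) of polynomials in the homogeneous coordinates
   x = 'X_0, y = 'X_1, z = 'X_2 stands either for the 1-form
   p_0 dx + p_1 dy + p_2 dz or for the rational map (p_0 : p_1 : p_2). *)
Notation mtriple K := (3.-tuple {mpoly K[3]}).

Section PolynomialTriples.
Variable K : fieldType.
Implicit Types (g p : {mpoly K[3]}) (t u : mtriple K).

Definition mdvd g p : Prop := exists q, p = q * g.

Definition common_divisor g t : Prop := forall i, mdvd g (tnth t i).

(* The units of {mpoly K[3]} are the nonzero constants; in particular this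
   fails for the zero triple, which 0 divides. *)
Definition no_common_factor t : Prop :=
  forall g, common_divisor g t -> g \is a GRing.unit.

Definition is_gcd h t : Prop :=
  common_divisor h t /\ forall g, common_divisor g t -> mdvd g h.

Definition homog_triple k t : Prop := forall i, tnth t i \is k.-homog.

(* The coefficient of dx_j in phi^* (sum_i w_i dx_i)
   is sum_i (w_i o phi) * d(phi_i)/d(x_j). *)
Definition pullback_form (phi w : mtriple K) : mtriple K :=
  [tuple \sum_(i < 3) (tnth w i \mPo phi) * (tnth phi i)^`M(j) | j < 3].

(* phi o psi is the identity as a rational map.  The requirement h != 0 also
   says that the composite is defined, i.e. that its components are not all
   zero. *)
Definition comp_is_id (phi psi : mtriple K) : Prop :=
  exists2 h : {mpoly K[3]}, h != 0 &
    forall i, tnth phi i \mPo psi = h * 'X_i.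

End PolynomialTriples.

(* A foliation is represented by a reduced 1-form; forms that differ by a
   nonzero scalar represent the same foliation. *)
Record foliation (K : fieldType) (d : nat) := Foliation {
  fol_form :> mtriple K;
  fol_homog : homog_triple d.+1 fol_form;
  fol_reduced : no_common_factor fol_form;
  fol_euler : \sum_(i < 3) 'X_i * tnth fol_form i = 0 }.

Record ratmap (K : fieldType) (k : nat) := Ratmap {
  ratmap_form :> mtriple K;
  ratmap_homog : homog_triple k ratmap_form;
  ratmap_reduced : no_common_factor ratmap_form }.

Definition birational (K : fieldType) (k : nat) (phi : ratmap K k) : Prop :=
  exists (l : nat) (psi : ratmap K l), comp_is_id phi psi /\ comp_is_id psi phi.

(* G = phi^* F.  The condition h != 0 rules out a vanishing pulled-back form, in which
   case there is no pulled-back foliation. *)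
Definition is_pullback (K : fieldType) (k d e : nat)
    (phi : ratmap K k) (F : foliation K d) (G : foliation K e) : Prop :=
  exists h : {mpoly K[3]},
    [/\ h != 0,
        is_gcd h (pullback_form phi F)
      & forall j, tnth (pullback_form phi F) j = h * tnth G j].

(* Main.v *)
Require Import Defs.
From mathcomp Require Import all_boot all_order all_algebra.
From mathcomp Require Import reals.
From mathcomp Require Import complex mpoly.
From mathcomp Require Import ring.

(* The pullback of a foliation of degree 2 by a quadratic birational map phi has
   coefficients of degree 7, so one has to find phi such that a cubic factors out.  A
   singular point of the foliation, possibly infinitely near, which is a base point of
   the inverse of phi contributes at least one to the degree of the common factor, so
   three singular points in quadratic position are enough.  They are found as follows.
   A singular point q exists by elimination.  Every eigendirection of the linear part at
   q is an infinitely near singular point.  If there is another singular point outside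
   the corresponding line, these three points work.  If the line is not invariant and the
   eigenvalues are not in resonance, there is a further infinitely near singular point on
   a conic osculating the foliation.  If the line is invariant, it contains other singular
   points, unless its eigenvalue at q is zero.  In the remaining cases, either q or a point
   infinitely near to it counts twice, or q is a cusp and another singular point is found
   by elimination. *)

Set Implicit Arguments.
Unset Strict Implicit.
Unset Printing Implicit Defensive.

Import GRing.Theory Num.Theory.
Local Open Scope ring_scope.

(** * Polynomials: composition, derivatives, homogeneity *)

Section MpolyComposition.
Variable K : fieldType.

Lemma mpoly_gen_ind n (P : {mpoly K[n]} -> Prop) :
    (forall c, P c%:MP) -> (forall i, P 'X_i) ->
    (forall p q, P p -> P q -> P (p + q)) ->
    (forall p q, P p -> P q -> P (p * q)) ->
  forall p, P p.
Proof.
move=> PC PX PD PM; elim/mpolyind => [|c m p _ _ Pp]; first by rewrite -mpolyC0.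
rewrite -mul_mpolyC; apply: (PD _ _ _ Pp); apply: (PM _ _ (PC c)).
rewrite mpolyXE_id; apply: (big_rec P) => [|i q _]; first by rewrite -mpolyC1.
apply: (PM ('X_i ^+ m i) q); elim: (m i) => [|k IH].
  by rewrite expr0 -mpolyC1.
by rewrite exprS; apply: PM.
Qed.

Lemma comp_mpolyA n k l (p : {mpoly K[n]}) (t : n.-tuple {mpoly K[k]})
    (u : k.-tuple {mpoly K[l]}) :
  (p \mPo t) \mPo u = p \mPo [tuple tnth t i \mPo u | i < n].
Proof.
elim/mpoly_gen_ind: p => [c|i|p q Hp Hq|p q Hp Hq].
- by rewrite !comp_mpolyC.
- by rewrite !comp_mpolyXU -!tnth_nth tnth_mktuple.
- by rewrite !comp_mpolyD Hp Hq.
- by rewrite !rmorphM /= Hp Hq.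
Qed.

Lemma mderivXU n i j : ('X_i : {mpoly K[n]})^`M(j) = (i == j)%:R.
Proof.
rewrite mderivX mnm1E; case: eqVneq => [<-|_]; last by rewrite scale0r.
by rewrite scale1r -{1}[U_(i)%MM]add0m addmK mpolyX0.
Qed.

Lemma mderiv_comp n k (p : {mpoly K[n]}) (t : n.-tuple {mpoly K[k]}) j :
  (p \mPo t)^`M(j) = \sum_(i < n) (p^`M(i) \mPo t) * (tnth t i)^`M(j).
Proof.
elim/mpoly_gen_ind: p => [c|i|p q Hp Hq|p q Hp Hq].
- rewrite comp_mpolyC mderivC big1 // => i _.
  by rewrite mderivC comp_mpoly0 mul0r.
- rewrite comp_mpolyXU -tnth_nth (bigD1 i) //= big1 => [|i' ne_i'i].
    by rewrite mderivXU eqxx comp_mpoly1 mul1r addr0.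
  by rewrite mderivXU eq_sym (negbTE ne_i'i) comp_mpoly0 mul0r.
- rewrite comp_mpolyD mderivD Hp Hq -big_split /=; apply: eq_bigr => i _.
  by rewrite mderivD comp_mpolyD mulrDl.
- rewrite rmorphM /= mderivM Hp Hq mulr_suml mulr_sumr -big_split /=.
  apply: eq_bigr => i _.
  by rewrite mderivM comp_mpolyD !rmorphM /=; ring.
Qed.

Lemma mdeg_dhomog n d (p : {mpoly K[n]}) m :
  p \is d.-homog -> m \in msupp p -> mdeg m = d.
Proof. by move=> hp; apply: (dhomog_mf hp). Qed.

Lemma dhomog_mderiv n d (p : {mpoly K[n]}) i :
  p \is d.+1.-homog -> p^`M(i) \is d.-homog.
Proof.
move=> hp; apply/dhomogP => m; rewrite mcoeff_msupp mcoeff_deriv => nz.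
have : (m + U_(i))%MM \in msupp p.
  by rewrite mcoeff_msupp; apply: contraNneq nz => ->; rewrite mul0rn.
by move/(mdeg_dhomog hp); rewrite mdegD mdeg1 addn1 => -[].
Qed.

Lemma dhomog_comp n k d e (p : {mpoly K[n]}) (t : n.-tuple {mpoly K[k]}) :
    p \is d.-homog -> (forall i, tnth t i \is e.-homog) ->
  p \mPo t \is (e * d).-homog.
Proof.
move=> hp ht; rewrite comp_mpolyE big_seq.
apply: rpred_sum => m /(mdeg_dhomog hp) <-.
apply: dhomogZ; rewrite mdegE big_distrr /=.
elim/big_ind2: _ => [|q1 d1 q2 d2|i _]; [exact: dhomog1 | exact: dhomogM |].
exact: dhomogMn.
Qed.

Lemma comp_mpoly_scale n d (p h : {mpoly K[n]}) :
  p \is d.-homog -> p \mPo [tuple h * 'X_i | i < n] = h ^+ d * p.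
Proof.
move=> hp; rewrite comp_mpolyE [in RHS](mpolyE p) mulr_sumr.
apply: eq_big_seq => m /(mdeg_dhomog hp) <-.
rewrite -scalerAr; congr (_ *: _).
rewrite mdegE -prodrXr (mpolyXE_id K m) -big_split /=; apply: eq_bigr => i _.
by rewrite tnth_mktuple exprMn.
Qed.

(** Each factor is a power of ['X] times a cofactor that does not vanish at 0. Comparing exponents
    leaves a constant product of cofactors, so the cofactor of [f] is constant. *)
Lemma poly_mul_monomial (D : idomainType) (f g : {poly D}) (c : D) d :
  c != 0 -> f * g = c%:P * 'X^d -> exists a k, f = a%:P * 'X^k.
Proof.
move=> c0 E.
have X0 k : 'X^k != 0 :> {poly D} by rewrite -size_poly_eq0 size_polyXn.
have fg0 : f * g != 0 by rewrite E mulf_neq0 // polyC_eq0.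
have [f0 g0] : f != 0 /\ g != 0 by apply/andP; rewrite -negb_or -mulf_eq0.
have [k [f1]] := multiplicity_XsubC f 0.
rewrite f0 /= subr0 => rf Ef.
have [l [g1]] := multiplicity_XsubC g 0.
rewrite g0 /= subr0 => rg Eg.
have r1 : (f1 * g1).[0] != 0 by rewrite hornerM mulf_neq0.
have {}E : f1 * g1 * 'X^(k + l) = c%:P * 'X^d.
  by rewrite -E Ef Eg exprD; ring.
have [lt|gt|eq] := ltngtP (k + l)%N d.
- case/negP: r1; have : f1 * g1 = c%:P * 'X^(d - (k + l)).
    by apply: (mulIf (X0 (k + l)%N)); rewrite E -mulrA -exprD subnK // ltnW.
  by move=> ->; rewrite hornerM hornerXn expr0n subn_eq0 leqNgt lt mulr0.
- case/negP: c0; have : c%:P = f1 * g1 * 'X^(k + l - d).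
    by apply: (mulIf (X0 d)); rewrite -E -[RHS]mulrA -exprD subnK // ltnW.
  move/(congr1 (horner^~ 0)); rewrite hornerC hornerM hornerXn expr0n subn_eq0.
  by rewrite leqNgt gt mulr0 => ->.
have {}E : f1 * g1 = c%:P by apply: (mulIf (X0 d)); rewrite -E eq.
have : size (f1 * g1) == 1 by rewrite E size_polyC c0.
rewrite size_mul_eq1 => /andP[/size_poly1P[a _ Ea] _].
by exists a, k; rewrite Ef Ea.
Qed.

(* p(T X), so that p is homogeneous if and only if grade p is a monomial in T. *)
Definition grade n (p : {mpoly K[n]}) : {poly {mpoly K[n]}} :=
  mmap ((polyC \o @mpolyC n K) : {rmorphism K -> {poly {mpoly K[n]}}})
    (fun i => ('X_i)%:P * 'X) p.

Lemma gradeD n : {morph @grade n : p q / p + q}.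
Proof. by move=> p q; rewrite /grade mmapD. Qed.

Lemma gradeM n : {morph @grade n : p q / p * q}.
Proof. by move=> p q; rewrite /grade rmorphM. Qed.

Lemma grade_horner1 n (p : {mpoly K[n]}) : (grade p).[1] = p.
Proof.
elim/mpoly_gen_ind: p => [c|i|p q Hp Hq|p q Hp Hq].
- by rewrite /grade mmapC /= hornerC.
- by rewrite /grade mmapX mmap1U hornerM hornerC hornerX mulr1.
- by rewrite gradeD hornerD; congr (_ + _).
- by rewrite gradeM hornerM; congr (_ * _).
Qed.

Lemma grade_homog n d (p : {mpoly K[n]}) :
  p \is d.-homog -> grade p = p%:P * 'X^d.
Proof.
move=> hp; rewrite /grade /mmap [in RHS](mpolyE p) rmorph_sum /= mulr_suml.
apply: eq_big_seq => m /(mdeg_dhomog hp) <-.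
rewrite -mul_mpolyC rmorphM /= -mulrA; congr (_ * _).
rewrite /mmap1 mpolyXE_id rmorph_prod /= mdegE -prodrXr -big_split /=.
by apply: eq_bigr => i _; rewrite exprMn rmorphXn.
Qed.

Lemma homog_grade n d (p a : {mpoly K[n]}) :
  grade p = a%:P * 'X^d -> p \is d.-homog.
Proof.
move=> E; have -> : p = (grade p)`_d.
  by rewrite -{1}(grade_horner1 p) E coefCM coefXn eqxx mulr1
     hornerM hornerC hornerXn expr1n mulr1.
rewrite /grade /mmap coef_sum; apply: rpred_sum => m _.
have -> : mmap1 (fun i => ('X_i)%:P * 'X) m = 'X_[m]%:P * 'X^(mdeg m)
    :> {poly {mpoly K[n]}}.
  rewrite /mmap1 mpolyXE_id rmorph_prod /= mdegE -prodrXr -big_split /=.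
  by apply: eq_bigr => i _; rewrite exprMn rmorphXn.
rewrite /= mulrA -polyCM coefCM coefXn mul_mpolyC.
have [->|_] := eqVneq; last by rewrite mulr0 rpred0.
by rewrite mulr1; apply: dhomogZ; rewrite dhomogX.
Qed.

(** [grade] is multiplicative, and a factor of a monomial in T is a monomial in T. *)
Lemma dhomog_divisor n d (p q : {mpoly K[n]}) :
  p * q != 0 -> p * q \is d.-homog -> exists k, p \is k.-homog.
Proof.
move=> nz /grade_homog; rewrite gradeM.
by case/(poly_mul_monomial nz) => a [k /homog_grade hp]; exists k.
Qed.

Lemma dhomog_mulIl n d e (p q : {mpoly K[n]}) :
  q != 0 -> q \is e.-homog -> p * q \is (d + e).-homog -> p \is d.-homog.
Proof.
move=> q0 hq hpq; have [->|p0] := eqVneq p 0; first exact: dhomog0.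
have pq0 : p * q != 0 by rewrite mulf_neq0.
have [k hp] := dhomog_divisor pq0 hpq.
by have /addIn <- := dhomog_uniq pq0 (dhomogM hp hq) hpq.
Qed.

End MpolyComposition.

(** * Common factors of pulled back forms *)

Section PullbackForms.
Variable K : fieldType.
Implicit Types (g h p q : {mpoly K[3]}) (w phi psi : mtriple K).

Definition comp_triple phi psi : mtriple K := [tuple tnth phi i \mPo psi | i < 3].

Lemma pullback_comp phi psi w :
  pullback_form (comp_triple phi psi) w = pullback_form psi (pullback_form phi w).
Proof.
apply: eq_from_tnth => j; rewrite !tnth_mktuple.
transitivity (\sum_(i < 3) \sum_(k < 3) ((tnth w i \mPo phi) \mPo psi) *
    ((tnth phi i)^`M(k) \mPo psi) * (tnth psi k)^`M(j)).
  apply: eq_bigr => i _; rewrite tnth_mktuple mderiv_comp comp_mpolyA mulr_sumr.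
  by apply: eq_bigr => k _; rewrite mulrA.
rewrite exchange_big; apply: eq_bigr => k _ /=.
rewrite tnth_mktuple rmorph_sum /= mulr_suml.
by apply: eq_bigr => i _; rewrite rmorphM.
Qed.

Definition euler_zero w := \sum_(i < 3) 'X_i * tnth w i = 0.

Lemma euler_homog d p :
  p \is d.-homog -> \sum_(j < 3) 'X_j * p^`M(j) = d%:R * p.
Proof.
move=> hp.
have E j : 'X_j * p^`M(j) = \sum_(m <- msupp p) (m j)%:R * (p@_m *: 'X_[m]).
  rewrite /mderiv mulr_sumr; apply: eq_bigr => m _.
  have [->|nz] := eqVneq (m j) 0%N; first by rewrite !mul0r scale0r mulr0.
  rewrite -scalerAr -mpolyXD addmC submK; last first.
    by apply/mnm_lepP => l; rewrite mnm1E; case: eqVneq => // <-; rewrite lt0n.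
  by rewrite -scalerA scaler_nat mulr_natl.
under eq_bigr do rewrite E; rewrite exchange_big [in RHS](mpolyE p) mulr_sumr.
apply: eq_big_seq => m /(mdeg_dhomog hp) <-.
by rewrite mdegE natr_sum mulr_suml.
Qed.

(** By Euler's identity, the contraction of phi^* w with the radial field is [k] times that of [w],
    composed with [phi]. *)
Lemma pullback_euler k phi w :
  homog_triple k phi -> euler_zero w -> euler_zero (pullback_form phi w).
Proof.
move=> hphi /(congr1 (comp_mpoly phi)); rewrite rmorph0 rmorph_sum /= => E.
rewrite /euler_zero.
transitivity (\sum_(i < 3) (tnth w i \mPo phi) *
    \sum_(j < 3) 'X_j * (tnth phi i)^`M(j)).
  under [RHS]eq_bigr do rewrite mulr_sumr.
  rewrite [RHS]exchange_big; apply: eq_bigr => j _ /=.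
  by rewrite tnth_mktuple mulr_sumr; apply: eq_bigr => i _; rewrite mulrCA.
transitivity (k%:R * \sum_(i < 3) (('X_i * tnth w i) \mPo phi)); last first.
  by rewrite E mulr0.
rewrite mulr_sumr; apply: eq_bigr => i _.
by rewrite (euler_homog (hphi i)) rmorphM /= comp_mpolyXU -tnth_nth; ring.
Qed.

Lemma pullback_homog d k phi w :
    homog_triple k.+1 phi -> homog_triple d w ->
  homog_triple (k.+1 * d + k) (pullback_form phi w).
Proof.
move=> hphi hw j; rewrite tnth_mktuple; apply: rpred_sum => i _.
apply: dhomogM; first exact: (dhomog_comp (hw i) hphi).
exact: (dhomog_mderiv j (hphi i)).
Qed.

(** The terms containing derivatives of [h] add up to a multiple of the Euler relation. *)
Lemma pullback_scale d h w j :
    homog_triple d w -> euler_zero w ->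
  tnth (pullback_form [tuple h * 'X_i | i < 3] w) j = h ^+ d.+1 * tnth w j.
Proof.
move=> hw ew; rewrite tnth_mktuple.
transitivity (h ^+ d * h^`M(j) * (\sum_(i < 3) 'X_i * tnth w i) +
   h ^+ d.+1 * \sum_(i < 3) tnth w i * (i == j)%:R).
  rewrite [_ * h^`M(j) * _]mulr_sumr [h ^+ d.+1 * _]mulr_sumr -big_split /=.
  apply: eq_bigr => i _.
  rewrite (comp_mpoly_scale _ (hw i)) tnth_mktuple mderivM mderivXU exprS.
  move: (_ == _)%:R => b; ring.
rewrite ew mulr0 add0r (bigD1 j) //= eqxx mulr1 big1 ?addr0 // => i /negbTE ->.
by rewrite mulr0.
Qed.

(** A monomial is kept as the list of its variables, so that products are concatenations, the degree
    is the length, and divisors are handled by induction. *)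
Definition mon (s : seq 'I_3) : {mpoly K[3]} := \prod_(i <- s) 'X_i.

Lemma mon_cat s1 s2 : mon (s1 ++ s2) = mon s1 * mon s2.
Proof. exact: big_cat. Qed.

Lemma mon_exp s k : mon s ^+ k = mon (flatten (nseq k s)).
Proof.
elim: k => [|k IH]; first by rewrite expr0 /mon big_nil.
by rewrite exprS IH -mon_cat.
Qed.

Lemma mpolyXU_neq0 i : 'X_i != 0 :> {mpoly K[3]}.
Proof. by rewrite -msize_poly_eq0 msizeX mdeg1. Qed.

Lemma mon_neq0 s : mon s != 0.
Proof.
rewrite /mon; elim/big_rec: _ => [|i q _ q0]; first exact: oner_neq0.
by rewrite mulf_neq0 // mpolyXU_neq0.
Qed.

Lemma mon_homog s : mon s \is (size s).-homog.
Proof.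
elim: s => [|i s IH]; first by rewrite /mon big_nil dhomog1.
rewrite /mon big_cons; apply: (@dhomogM _ _ _ 1); last exact: IH.
by rewrite dhomogX /= mdeg1.
Qed.

Lemma mdvd_trans g p q : mdvd g p -> mdvd p q -> mdvd g q.
Proof. by move=> [a ->] [b ->]; exists (b * a); rewrite mulrA. Qed.

Lemma mdvd_mull g p q : mdvd g p -> mdvd g (q * p).
Proof. by move=> [a ->]; exists (q * a); rewrite mulrA. Qed.

Lemma mdvd_add g p q : mdvd g p -> mdvd g q -> mdvd g (p + q).
Proof. by move=> [a ->] [b ->]; exists (a + b); rewrite mulrDl. Qed.

Lemma mdvd_sum g (F : 'I_3 -> {mpoly K[3]}) :
  (forall i, mdvd g (F i)) -> mdvd g (\sum_(i < 3) F i).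
Proof.
move=> gF; elim/big_ind: _ => [|p q|i _]; [|exact: mdvd_add | exact: gF].
by exists 0; rewrite mul0r.
Qed.

Lemma mdvd_comp g p (t : mtriple K) : mdvd g p -> mdvd (g \mPo t) (p \mPo t).
Proof. by move=> [a ->]; exists (a \mPo t); rewrite rmorphM. Qed.

Lemma mdvd1_unit g : mdvd g 1 -> g \is a GRing.unit.
Proof. by move=> [a E]; apply/unitrP; exists a; rewrite [g * a]mulrC -E. Qed.

(** The substitution of 0 for ['X_i]; its kernel is the ideal generated by ['X_i], which is
    therefore prime. *)
Definition kill (i : 'I_3) : mtriple K :=
  [tuple (if j == i then 0 else 'X_j) | j < 3].

Lemma mdvdX_sub_kill i p : mdvd 'X_i (p - (p \mPo kill i)).
Proof.
elim/mpoly_gen_ind: p => [c|j|p q [a Ea] [b Eb]|p q [a Ea] [b Eb]].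
- by exists 0; rewrite comp_mpolyC subrr mul0r.
- rewrite comp_mpolyXU -tnth_nth tnth_mktuple.
  case: eqVneq => [->|_]; first by exists 1; rewrite subr0 mul1r.
  by exists 0; rewrite subrr mul0r.
- by exists (a + b); rewrite comp_mpolyD mulrDl -Ea -Eb; ring.
- exists (a * q + (p \mPo kill i) * b); rewrite rmorphM /=.
  by rewrite mulrDl -mulrA (mulrC q) mulrA -Ea -mulrA -Eb; ring.
Qed.

Lemma mdvdX_kill i p : mdvd 'X_i p <-> p \mPo kill i = 0.
Proof.
split=> [[a ->]|E]; last by have := mdvdX_sub_kill i p; rewrite E subr0.
by rewrite rmorphM /= comp_mpolyXU -tnth_nth tnth_mktuple eqxx mulr0.
Qed.

Lemma mdvdX_prime i p q : mdvd 'X_i (p * q) -> mdvd 'X_i p \/ mdvd 'X_i q.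
Proof.
move/mdvdX_kill/eqP; rewrite rmorphM mulf_eq0 => /orP[] /eqP /mdvdX_kill.
  by left.
by right.
Qed.

(** Variables leave [s] one at a time: one that divides [g] is cancelled from both sides, any other
    divides the cofactor, being prime. In the end [g] divides all coefficients of the reduced
    form. *)
Lemma mdvd_mon_strip s g w :
    no_common_factor w -> (forall j, mdvd g (mon s * tnth w j)) ->
  mdvd g (mon s).
Proof.
move=> nw; elim: s g => [|i s IH] g gw.
  have /nw ug : common_divisor g w.
    by move=> j; have := gw j; rewrite /mon big_nil mul1r.
  by exists g^-1; rewrite /mon big_nil mulVr.
have monE p : mon (i :: s) * p = 'X_i * (mon s * p) by rewrite /mon big_cons mulrA.
have X0 : 'X_i != 0 :> {mpoly K[3]} by rewrite mpolyXU_neq0.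
have [g0|/eqP g0] := eqVneq (g \mPo kill i) 0.
  have /mdvdX_kill [g1 Eg] := g0.
  have [j|a Ea] := IH g1.
    have [a Ea] := gw j; exists a; apply: (mulfI X0).
    by rewrite -monE Ea Eg; ring.
  by exists a; rewrite -[mon _]mulr1 monE mulr1 Ea Eg; ring.
have [j|a Ea] := IH g; last first.
  by exists (a * 'X_i); rewrite -[mon _]mulr1 monE mulr1 Ea; ring.
have [a Ea] := gw j; have : mdvd 'X_i (a * g).
  by rewrite -Ea monE mulrC; exists (mon s * tnth w j).
case/mdvdX_prime => [[b Eb]|/mdvdX_kill //].
exists b; apply: (mulfI X0); by rewrite -monE Ea Eb; ring.
Qed.

Lemma mdvd_mon s g :
  mdvd g (mon s) -> g \is a GRing.unit \/ exists i, mdvd 'X_i g.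
Proof.
elim: s => [|i s IH] [a].
  by rewrite /mon big_nil => E; left; apply: mdvd1_unit; exists a.
rewrite /mon big_cons => E; have : mdvd 'X_i (a * g).
  by rewrite -E mulrC; exists (mon s).
case/mdvdX_prime => [[b Eb]|ig]; last by right; exists i.
apply: IH; exists b; apply: (mulfI (_ : 'X_i != 0)); first by rewrite mpolyXU_neq0.
by rewrite E Eb; ring.
Qed.

(** Dividing out a variable common to all coefficients lowers the degree, hence the induction on
    [d]. *)
Lemma extract_variables d w :
    homog_triple d w -> (exists j, tnth w j != 0) ->
  exists s k (v : mtriple K),
    [/\ homog_triple k v, forall j, tnth w j = mon s * tnth v j,
        forall i, ~ common_divisor 'X_i v & (k <= d)%N].
Proof.
elim: d w => [|d IH] w hw [j0 nzj].
  exists [::], 0%N, w; split=> // [j|i /(_ j0) [q E]].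
    by rewrite /mon big_nil mul1r.
  have [k hq] : exists k, q \is k.-homog.
    by apply: (dhomog_divisor (q := 'X_i) (d := 0)); rewrite -E.
  have X1 : ('X_i : {mpoly K[3]}) \is 1.-homog by rewrite dhomogX /= mdeg1.
  have := dhomogM hq X1; rewrite -E => /(dhomog_uniq nzj (hw j0)).
  by rewrite addn1.
have [/existsP[i /forallP iw]|/existsPn ni] :=
    boolP [exists i, [forall j, tnth w j \mPo kill i == 0]]; last first.
  exists [::], d.+1, w; split=> // [j|i iw].
    by rewrite /mon big_nil mul1r.
  have /forallPn[j /negP[]] := ni i.
  by apply/eqP/mdvdX_kill/iw.
have /fin_all_exists[q Eq] : forall j, exists q, tnth w j = q * 'X_i.
  by move=> j; apply/mdvdX_kill/eqP/iw.
have X1 : ('X_i : {mpoly K[3]}) \is 1.-homog by rewrite dhomogX /= mdeg1.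
have [j||s [k [v [hv Ev nv le_kd]]]] := IH [tuple q j | j < 3].
- rewrite tnth_mktuple; apply: (dhomog_mulIl _ X1); first by rewrite mpolyXU_neq0.
  by rewrite -Eq addn1; apply: hw.
- by exists j0; apply: contraNneq nzj; rewrite tnth_mktuple Eq => ->; rewrite mul0r.
exists (i :: s), k, v; split=> //; last exact: leqW.
move=> j; rewrite Eq -[q j](tnth_mktuple q) Ev /mon big_cons; ring.
Qed.

(** Differentiating the Euler relation with respect to the variable of index [j] isolates the
    constant coefficient. *)
Lemma euler_homog0 w : homog_triple 0 w -> euler_zero w -> forall j, tnth w j = 0.
Proof.
move=> hw ew j.
have d0 i : (tnth w i)^`M(j) = 0.
  apply/mpolyP => m; rewrite mcoeff_deriv mcoeff0.
  rewrite (dhomog_nemf_coeff (hw i)) ?mul0rn //= mdegD mdeg1 addn1 //.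
have := congr1 (mderiv j) ew; rewrite linear0 linear_sum /= (bigD1 j) //=.
rewrite mderivM mderivXU eqxx mul1r d0 mulr0 addr0 big1 ?addr0 // => i /negbTE ij.
by rewrite mderivM mderivXU ij d0 mulr0 mul0r addr0.
Qed.

(* A common factor g of the coefficients left after extracting the variables from
   phi^* w would give, composed with psi, a factor of (phi o psi)^* w = (mon s)^4 w;
   as w is reduced, this factor is a monomial, and composing back with phi shows that
   g itself divides a monomial. *)
Lemma pullback_monomial_cremona phi psi s s' s'' r w (W0 : mtriple K) :
    homog_triple 3 w -> no_common_factor w -> euler_zero w ->
    homog_triple 2 phi -> size r = 3 ->
    (forall i, tnth phi i \mPo psi = mon s * 'X_i) ->
    (forall i, tnth psi i \mPo phi = mon s' * 'X_i) ->
    mon s \mPo phi = mon s'' ->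
    (forall j, tnth (pullback_form phi w) j = mon r * tnth W0 j) ->
  exists e (G : foliation K e) h,
    [/\ h != 0, is_gcd h (pullback_form phi w),
        forall j, tnth (pullback_form phi w) j = h * tnth G j & (e <= 3)%N].
Proof.
move=> hw nw ew hphi sr Hphi Hpsi Hs; set pb := pullback_form phi w => HW.
(* The exponent is the degree 3 of the coefficients plus one from the differentials. *)
have key j : tnth (pullback_form psi pb) j = mon s ^+ 4 * tnth w j.
  rewrite -pullback_comp.
  have -> : comp_triple phi psi = [tuple mon s * 'X_i | i < 3].
    by apply: eq_from_tnth => i; rewrite !tnth_mktuple.
  exact: pullback_scale hw ew.
have pb_nz : exists j, tnth pb j != 0.
  apply/existsP; apply: contraT => /existsPn pb0.
  have w0 j : tnth w j = 0.
    apply/eqP; have := key j; rewrite tnth_mktuple big1 => [/esym/eqP|i _].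
      by rewrite mulf_eq0 expf_eq0 /= (negbTE (mon_neq0 _)).
    by have := pb0 i; rewrite negbK => /eqP ->; rewrite comp_mpoly0 mul0r.
  have /nw : common_divisor 0 w by move=> j; exists 0; rewrite w0 mul0r.
  by rewrite unitr0.
have hpb : homog_triple 7 pb by apply: (pullback_homog (k := 1) hphi hw).
have hW0 : homog_triple 4 W0.
  move=> j; apply: (dhomog_mulIl (mon_neq0 r) (mon_homog r)).
  by rewrite mulrC -HW sr; apply: hpb.
have W0_nz : exists j, tnth W0 j != 0.
  have [j nz] := pb_nz; exists j; apply: contraNneq nz.
  by rewrite HW => ->; rewrite mulr0.
have [s1 [k [v [hv Ev nv le_k4]]]] := extract_variables hW0 W0_nz.
have pbE j : tnth pb j = mon (r ++ s1) * tnth v j.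
  by rewrite HW Ev mon_cat mulrA.
have rv : no_common_factor v.
  move=> g gv.
  have [l hg] : exists l, g \is l.-homog.
    have [j nz] := W0_nz; have [q Eq] := gv j.
    have vnz : g * q != 0.
      by rewrite mulrC -Eq; apply: contraNneq nz; rewrite Ev => ->; rewrite mulr0.
    apply: (dhomog_divisor vnz (d := k)); rewrite mulrC -Eq; exact: hv.
  have : mdvd (g \mPo psi) (mon s ^+ 4).
    rewrite mon_exp; apply: (mdvd_mon_strip nw) => j.
    rewrite -mon_exp -key tnth_mktuple; apply: mdvd_sum => i.
    rewrite mulrC; apply/mdvd_mull/mdvd_comp; rewrite pbE.
    exact/mdvd_mull/gv.
  move/(mdvd_comp phi); rewrite comp_mpolyA rmorphXn /= Hs mon_exp.
  have -> : [tuple tnth psi i \mPo phi | i < 3] = [tuple mon s' * 'X_i | i < 3].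
    by apply: eq_from_tnth => i; rewrite !tnth_mktuple.
  rewrite (comp_mpoly_scale _ hg) => gd.
  have {gd} : mdvd g (mon (flatten (nseq 4 s''))).
    by apply: mdvd_trans gd; exists (mon s' ^+ l).
  case/mdvd_mon => // -[i ig]; case: (nv i) => j.
  exact: mdvd_trans ig (gv j).
have ev : euler_zero v.
  apply: (mulfI (mon_neq0 (r ++ s1))); rewrite mulr0 mulr_sumr.
  rewrite -[RHS](pullback_euler hphi ew); apply: eq_bigr => j _.
  by rewrite -/pb pbE mulrCA.
(* Degree 0 contradicts the Euler relation; coefficients of degree [e.+1] define a foliation of
   degree [e]. *)
case: k hv le_k4 => [hv|e hv le_e3].
  have [j] := W0_nz; rewrite Ev (euler_homog0 hv ev) mulr0 eqxx //.
exists e, (Foliation hv rv ev), (mon (r ++ s1)); split=> //.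
  exact: mon_neq0.
split=> [j|g gpb]; first by rewrite pbE mulrC; exists (tnth v j).
by apply: (mdvd_mon_strip rv) => j; rewrite -pbE.
Qed.

End PullbackForms.

(** * Invariance of the conclusion under linear changes of coordinates *)

Section QuadraticPullbacks.
Variable K : fieldType.
Implicit Types (w L phi psi : mtriple K).

Definition idt : mtriple K := [tuple 'X_i | i < 3].

(** The conclusion of the theorem for a 1-form. Reducedness is a premise inside, so that changes of
    coordinates transport the property as a whole. *)
Definition good w := no_common_factor w ->
  exists psi : ratmap K 2, birational psi /\
    exists e (G : foliation K e) h,
    [/\ h != 0, is_gcd h (pullback_form psi w),
        forall j, tnth (pullback_form psi w) j = h * tnth G j & (e <= 3)%N].

Lemma comp_idt (p : {mpoly K[3]}) : p \mPo idt = p.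
Proof. exact: comp_mpoly_id. Qed.

Lemma comp_tripleK L L' (p : {mpoly K[3]}) :
  comp_triple L L' = idt -> (p \mPo L) \mPo L' = p.
Proof. by move=> LL'; rewrite comp_mpolyA -/(comp_triple L L') LL' comp_idt. Qed.

Lemma reduced_comp L L' w :
    comp_triple L L' = idt -> comp_triple L' L = idt ->
    no_common_factor w -> no_common_factor (comp_triple w L).
Proof.
move=> LL' L'L nw g gw; rewrite -(comp_tripleK g L'L).
apply: rmorph_unit; apply: nw => i; rewrite -(comp_tripleK (tnth w i) LL').
by apply: mdvd_comp; have := gw i; rewrite tnth_mktuple.
Qed.

(** The components of [w] are linear combinations of those of L o w, so a common divisor of the
    latter divides the former. *)
Lemma reduced_linear_comp L L' w :
    homog_triple 1 L' -> comp_triple L' L = idt ->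
    no_common_factor w -> no_common_factor (comp_triple L w).
Proof.
move=> hL' L'L nw g gw; apply: nw => j.
have -> : tnth w j = tnth L' j \mPo comp_triple L w.
  rewrite -comp_mpolyA -[tnth L' j \mPo L](tnth_mktuple (fun i => tnth L' i \mPo L)).
  by rewrite -/(comp_triple L' L) L'L tnth_mktuple comp_mpolyXU -tnth_nth.
have := euler_homog (hL' j); rewrite mul1r => <-.
rewrite rmorph_sum /=; apply: mdvd_sum => i.
by rewrite rmorphM /= comp_mpolyXU -tnth_nth mulrC; apply: mdvd_mull.
Qed.

Lemma pullback_idt d w :
  homog_triple d w -> euler_zero w -> pullback_form idt w = w.
Proof.
move=> hw ew; have -> : idt = [tuple 1 * 'X_i | i < 3].
  by apply: eq_from_tnth => i; rewrite !tnth_mktuple mul1r.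
by apply: eq_from_tnth => j; rewrite (pullback_scale _ _ hw ew) expr1n mul1r.
Qed.

(** If psi0 works for L^* w, then L o psi0 works for [w], since pulling back is contravariant; its
    inverse is phi0 o L'. *)
Lemma good_linear L L' d w :
    homog_triple 1 L -> homog_triple 1 L' ->
    comp_triple L L' = idt -> comp_triple L' L = idt ->
    homog_triple d w -> euler_zero w ->
  good (pullback_form L w) -> good w.
Proof.
move=> hL hL' LL' L'L hw ew gLw nw.
have [|psi0 [[l [phi0 [[h0 nz0 E0] [h1 nz1 E1]]]] [e [G [h H]]]]] := gLw.
  move=> g gw; rewrite -(comp_tripleK g L'L).
  apply: rmorph_unit; apply: nw => j.
  rewrite -[X in tnth X j](pullback_idt hw ew) -LL' pullback_comp.
  move: (pullback_form L w) gw => pb gw; rewrite tnth_mktuple.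
  by apply: mdvd_sum => i; rewrite mulrC; apply/mdvd_mull/mdvd_comp/gw.
have hpsi : homog_triple 2 (comp_triple L psi0).
  move=> i; rewrite tnth_mktuple.
  exact: (dhomog_comp (e := 2) (hL i) (ratmap_homog psi0)).
have npsi := reduced_linear_comp hL' L'L (ratmap_reduced (r := psi0)).
have hphi : homog_triple l (comp_triple phi0 L').
  move=> i; rewrite tnth_mktuple.
  by have := dhomog_comp (ratmap_homog phi0 i) hL'; rewrite mul1n.
have nphi := reduced_comp L'L LL' (ratmap_reduced (r := phi0)).
exists (Ratmap hpsi npsi); split; last first.
  by exists e, G, h; rewrite /= pullback_comp.
exists l, (Ratmap hphi nphi); split=> /=.
- exists (h0 \mPo L').
    apply: contraNneq nz0 => /(congr1 (comp_mpoly L)).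
    by rewrite (comp_tripleK _ L'L) rmorph0 => ->.
  move=> i; rewrite tnth_mktuple comp_mpolyA.
  have -> : [tuple tnth psi0 k \mPo comp_triple phi0 L' | k < 3] =
      comp_triple [tuple h0 * 'X_k | k < 3] L'.
    by apply: eq_from_tnth => k; rewrite !tnth_mktuple -comp_mpolyA E0.
  rewrite -comp_mpolyA (comp_mpoly_scale _ (hL i)) expr1 rmorphM /=.
  congr (_ * _); rewrite -[LHS](tnth_mktuple (fun i => tnth L i \mPo L')).
  by rewrite -/(comp_triple L L') LL' tnth_mktuple.
- exists h1 => // i.
  rewrite tnth_mktuple -E1 comp_mpolyA; congr (_ \mPo _).
  apply: eq_from_tnth => k; rewrite tnth_mktuple -comp_mpolyA.
  rewrite -[tnth L' k \mPo L](tnth_mktuple (fun i => tnth L' i \mPo L)).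
  by rewrite -/(comp_triple L' L) L'L tnth_mktuple comp_mpolyXU -tnth_nth.
Qed.

Lemma good_monomial_cremona phi psi s s' s'' r w (W0 : mtriple K) :
    homog_triple 3 w -> euler_zero w ->
    homog_triple 2 phi -> no_common_factor phi ->
    homog_triple 2 psi -> no_common_factor psi -> size r = 3 ->
    (forall i, tnth phi i \mPo psi = mon K s * 'X_i) ->
    (forall i, tnth psi i \mPo phi = mon K s' * 'X_i) ->
    mon K s \mPo phi = mon K s'' ->
    (forall j, tnth (pullback_form phi w) j = mon K r * tnth W0 j) ->
  good w.
Proof.
move=> hw ew hphi nphi hpsi npsi sr E E' Es EW nw.
exists (Ratmap hphi nphi); split.
  exists 2%N, (Ratmap hpsi npsi); split.
    by exists (mon K s); first exact: mon_neq0.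
  by exists (mon K s'); first exact: mon_neq0.
exact: (pullback_monomial_cremona hw nw ew hphi sr E E' Es EW).
Qed.

End QuadraticPullbacks.

(** * Foliations of degree 2 in coordinates *)

Notation i0 := (@Ordinal 3 0 isT).
Notation i1 := (@Ordinal 3 1 isT).
Notation i2 := (@Ordinal 3 2 isT).

Lemma forall3 (P : 'I_3 -> Prop) : P i0 -> P i1 -> P i2 -> forall i, P i.
Proof.
move=> P0 P1 P2 [[|[|[|//]]] lt_i].
- by rewrite (_ : Ordinal lt_i = i0) //; apply: val_inj.
- by rewrite (_ : Ordinal lt_i = i1) //; apply: val_inj.
- by rewrite (_ : Ordinal lt_i = i2) //; apply: val_inj.
Qed.

Lemma sum3 (V : nmodType) (F : 'I_3 -> V) :
  \sum_(i < 3) F i = F i0 + F i1 + F i2.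
Proof.
rewrite !big_ord_recr big_ord0 /= add0r.
by congr (F _ + F _ + F _); apply: val_inj.
Qed.

(** Fifteen is the dimension of the space of 1-forms with cubic coefficients that vanish on the
    radial field. *)
Record vf (K : Type) := VF {
  cp0 : K; cp1 : K; cp2 : K; cp3 : K; cp4 : K; cp5 : K;
  cq0 : K; cq1 : K; cq2 : K; cq3 : K; cq4 : K; cq5 : K;
  cg0 : K; cg1 : K; cg2 : K }.

Definition quad (S : comNzRingType) (a0 a1 a2 a3 a4 a5 x y z : S) : S :=
  a0 * z ^+ 2 + a1 * x * z + a2 * y * z + a3 * x ^+ 2 + a4 * x * y + a5 * y ^+ 2.

(* In the affine chart z = 1 this is the 1-form dual to the vector field
   (P + x g) d/dx + (Q + y g) d/dy, where P, Q are quadratic polynomials and g is a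
   quadratic form; the scalars are mapped into S by c.  The point (0:0:1) is singular if
   p0 = q0 = 0, and then the linear part there is (p1 x + p2 y) d/dx + (q1 x + q2 y) d/dy,
   so that y = 0 is an eigendirection if q1 = 0.  The point (1:0:0) is singular if
   q3 = g0 = 0 and (0:1:0) is singular if p5 = g2 = 0. *)
Definition form (K : fieldType) (S : comNzRingType) (c : K -> S) (v : vf K)
    (X : 'I_3 -> S) (j : 'I_3) : S :=
  let: VF p0 p1 p2 p3 p4 p5 q0 q1 q2 q3 q4 q5 g0 g1 g2 := v in
  let x := X i0 in let y := X i1 in let z := X i2 in
  let P := quad (c p0) (c p1) (c p2) (c p3) (c p4) (c p5) x y z in
  let Q := quad (c q0) (c q1) (c q2) (c q3) (c q4) (c q5) x y z in
  let g := c g0 * x ^+ 2 + c g1 * x * y + c g2 * y ^+ 2 in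
  nth 0 [:: z * Q + y * g; - (z * P + x * g); y * P - x * Q] j.

Definition mx3 (K : fieldType) (r0 r1 r2 : seq K) : 'M[K]_3 :=
  \matrix_(i, j) nth 0 (nth [::] [:: r0; r1; r2] i) j.

Section Moves.
Variable K : fieldType.
Implicit Types (v : vf K) (M N : 'M[K]_3).
Local Notation vf := (vf K).

Definition om v : mtriple K :=
  [tuple form (@mpolyC 3 K) v (fun k => 'X_k) i | i < 3].

Definition sing v (X : 'I_3 -> K) := forall j, form idfun v X j = 0.

Lemma om_comp v (t : mtriple K) i :
  tnth (om v) i \mPo t = form (@mpolyC 3 K) v (tnth t) i.
Proof.
rewrite tnth_mktuple; case: v => *; rewrite /form /quad.
have tE j : 'X_j \mPo t = tnth t j by rewrite comp_mpolyXU -tnth_nth.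
by move: i; apply: forall3 => /=;
  rewrite !(rmorphN, rmorphB, rmorphD, rmorphM, rmorphXn) /=
    !comp_mpolyC !tE.
Qed.

Lemma om_euler v : euler_zero (om v).
Proof.
by rewrite /euler_zero sum3 !tnth_mktuple; case: v => * /=; rewrite /quad; ring.
Qed.

Lemma om_homog v : homog_triple 3 (om v).
Proof.
have X1 i : ('X_i : {mpoly K[3]}) \is 1.-homog by rewrite dhomogX /= mdeg1.
have XX c i j : (c%:MP * 'X_i * 'X_j : {mpoly K[3]}) \is 2.-homog.
  by rewrite -mulrA mul_mpolyC; apply/dhomogZ/(dhomogM (X1 i) (X1 j)).
have X2 c i : (c%:MP * 'X_i ^+ 2 : {mpoly K[3]}) \is 2.-homog.
  by rewrite expr2 mulrA.
have XM i (p : {mpoly K[3]}) : p \is 2.-homog -> 'X_i * p \is 3.-homog.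
  exact: dhomogM (X1 i).
move=> i; rewrite tnth_mktuple; case: v => *; rewrite /form /quad.
by move: i; apply: forall3 => /=; rewrite ?rpredN; do ?apply: rpredD;
  rewrite ?rpredN; apply: XM; do ?apply: rpredD.
Qed.

Definition lin M : mtriple K := [tuple \sum_(k < 3) (M i k)%:MP * 'X_k | i < 3].

Lemma lin_homog M : homog_triple 1 (lin M).
Proof.
move=> i; rewrite tnth_mktuple; apply: rpred_sum => k _.
by rewrite mul_mpolyC; apply: dhomogZ; rewrite dhomogX /= mdeg1.
Qed.

Lemma lin_comp M N : M *m N = 1%:M -> comp_triple (lin M) (lin N) = idt K.
Proof.
move=> MN; apply: eq_from_tnth => i; rewrite !tnth_mktuple.
have -> : 'X_i = \sum_(k < 3) (((M *m N) i k)%:MP * 'X_k : {mpoly K[3]}).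
  rewrite MN (bigD1 i) //= mxE eqxx mul1r big1 ?addr0 // => k /negbTE ki.
  by rewrite mxE eq_sym ki mul0r.
rewrite rmorph_sum /=; under eq_bigr => k _.
  rewrite rmorphM /= comp_mpolyC comp_mpolyXU -tnth_nth tnth_mktuple mulr_sumr.
  over.
rewrite exchange_big /=; apply: eq_bigr => k _.
by rewrite mxE rmorph_sum mulr_suml; apply: eq_bigr => l _; rewrite rmorphM mulrA.
Qed.

(** Quantifying over [S] lets one ring computation serve both the pulled back forms, over
    polynomials, and the singular points, over [K]. *)
Definition pullback_lin M v v' :=
  forall (S : comNzRingType) (c : {rmorphism K -> S}) (X : 'I_3 -> S) j,
  form c v' X j =
  \sum_(i < 3) form c v (fun i => \sum_(k < 3) c (M i k) * X k) i * c (M i j).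

Lemma good_pullback_lin M N v v' :
  M *m N = 1%:M -> pullback_lin M v v' -> good (om v') -> good (om v).
Proof.
move=> MN vv'; have NM := mulmx1C MN.
have -> : om v' = pullback_form (lin M) (om v).
  apply: eq_from_tnth => j; rewrite !tnth_mktuple vv'.
  apply: eq_bigr => i _; rewrite (om_comp v (lin M) i); congr (_ * _); last first.
    rewrite tnth_mktuple linear_sum (bigD1 j) //=.
    rewrite mderiv_mulC mderivXU eqxx mulr1 big1 ?addr0 // => k /negbTE kj.
    by rewrite mderiv_mulC mderivXU kj mulr0.
  case: v {vv'} => *; rewrite /form /quad.
  by move: i; apply: forall3; rewrite /= !tnth_mktuple.
apply: (good_linear (L' := lin N) (d := 3)).
- exact: lin_homog.
- exact: lin_homog.
- exact: lin_comp.
- exact: lin_comp.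
- exact: om_homog.
- exact: om_euler.
Qed.

Lemma sing_pullback_lin M v v' X X' :
    pullback_lin M v v' -> (forall i, X i = \sum_(k < 3) M i k * X' k) ->
  sing v X -> sing v' X'.
Proof.
move=> vv' XX' sX j; rewrite (vv' K idfun) big1 // => i _.
suff -> : form idfun v (fun i => \sum_(k < 3) idfun (M i k) * X' k) i = 0.
  by rewrite mul0r.
transitivity (form idfun v X i); last exact: sX.
case: v {vv' sX} => *; rewrite /form /quad.
by move: i; apply: forall3; rewrite /= !XX'.
Qed.

End Moves.

(** * Explicit coordinate changes *)

Section ElementaryMoves.
Variable K : fieldType.
Implicit Types (v : vf K).
Local Notation vf := (vf K).

Ltac pullback_lin_tac v :=
  move=> S c X; case: v => ? ? ? ? ? ? ? ? ? ? ? ? ? ? ?;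
  apply: forall3; rewrite sum3 /form /quad /=;
  rewrite !sum3 !mxE /= /quad; ring.

Ltac mx3_tac :=
  apply/matrixP; do 2![apply: forall3]; rewrite !mxE sum3 !mxE /=; ring.

(** Fixes (0:0:1) and turns the line y = t x into y = 0. *)
Definition shear (t : K) (v : vf) : vf :=
  let: VF p0 p1 p2 p3 p4 p5 q0 q1 q2 q3 q4 q5 g0 g1 g2 := v in
  VF
    p0 (p1 + p2 * t) p2 (p3 + p4 * t + p5 * t ^+ 2) (p4 + 2 * p5 * t) p5
    (q0 - p0 * t) (q1 + q2 * t - p1 * t - p2 * t ^+ 2) (q2 - p2 * t)
    (q3 + q4 * t + q5 * t ^+ 2 - p3 * t - p4 * t ^+ 2 - p5 * t ^+ 3)
    (q4 + 2 * q5 * t - p4 * t - 2 * p5 * t ^+ 2) (q5 - p5 * t)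
    (g1 * t + g2 * t ^+ 2 + g0) (2 * g2 * t + g1) g2.

Lemma shear_pullback (t : K) v :
  pullback_lin
    (mx3 [:: 1; 0; 0] [:: t; 1; 0] [:: 0; 0; 1]) v (shear t v).
Proof. by pullback_lin_tac v. Qed.

Lemma good_shear (t : K) v : good (om (shear t v)) -> good (om v).
Proof.
apply: (good_pullback_lin
  (N := mx3 [:: 1; 0; 0] [:: - t; 1; 0] [:: 0; 0; 1]));
  last exact: shear_pullback.
by mx3_tac.
Qed.

(* The transported vector field is dual to the opposite of the pulled back 1-form, because
   the swap reverses the orientation; hence the signs. *)
Definition swapxy (v : vf) : vf :=
  let: VF p0 p1 p2 p3 p4 p5 q0 q1 q2 q3 q4 q5 g0 g1 g2 := v in
  VF
    (- q0) (- q2) (- q1) (- q5) (- q4) (- q3)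
    (- p0) (- p2) (- p1) (- p5) (- p4) (- p3)
    (- g2) (- g1) (- g0).

Lemma swapxy_pullback v :
  pullback_lin
    (mx3 [:: 0; 1; 0] [:: 1; 0; 0] [:: 0; 0; 1]) v (swapxy v).
Proof. by pullback_lin_tac v. Qed.

Lemma good_swapxy v : good (om (swapxy v)) -> good (om v).
Proof.
apply: (good_pullback_lin
  (N := mx3 [:: 0; 1; 0] [:: 1; 0; 0] [:: 0; 0; 1]));
  last exact: swapxy_pullback.
by mx3_tac.
Qed.

Definition swapxz (v : vf) : vf :=
  let: VF p0 p1 p2 p3 p4 p5 q0 q1 q2 q3 q4 q5 g0 g1 g2 := v in
  VF
    g0 p3 g1 p1 p4 g2
    (- q3) (- q1) (p3 - q4) (- q0) (p1 - q2) (p4 - q5)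
    p0 p2 p5.

Lemma swapxz_pullback v :
  pullback_lin
    (mx3 [:: 0; 0; 1] [:: 0; 1; 0] [:: 1; 0; 0]) v (swapxz v).
Proof. by pullback_lin_tac v. Qed.

Lemma good_swapxz v : good (om (swapxz v)) -> good (om v).
Proof.
apply: (good_pullback_lin
  (N := mx3 [:: 0; 0; 1] [:: 0; 1; 0] [:: 1; 0; 0]));
  last exact: swapxz_pullback.
by mx3_tac.
Qed.

(** Fixes the line y = 0 pointwise and moves (s:1:t) to (0:1:0). *)
Definition movey (s t : K) (v : vf) : vf :=
  let: VF p0 p1 p2 p3 p4 p5 q0 q1 q2 q3 q4 q5 g0 g1 g2 := v in
  VF
    (- q0 * s + p0) (- q1 * s + p1 + q0 * t)
    (- 2 * q0 * s * t - q1 * s ^+ 2 - q2 * s + 2 * p0 * t + p1 * s + p2)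
    (- q3 * s + p3 + q1 * t)
    (- 2 * q3 * s ^+ 2 - q4 * s + p1 * t + 2 * p3 * s + p4
     + 2 * q0 * t ^+ 2 + q2 * t)
    (- q0 * s * t ^+ 2 - q1 * s ^+ 2 * t - q2 * s * t - q3 * s ^+ 3
     - q4 * s ^+ 2 - q5 * s + p0 * t ^+ 2 + p1 * s * t + p2 * t
     + p3 * s ^+ 2 + p4 * s + p5)
    q0 q1 (3 * q0 * t + q1 * s + q2) q3 (2 * q1 * t + 2 * q3 * s + q4)
    (3 * q0 * t ^+ 2 + 2 * q1 * s * t + 2 * q2 * t + q3 * s ^+ 2 + q4 * s
     + q5)
    (q3 * t + g0) (q1 * t ^+ 2 + 2 * q3 * s * t + q4 * t + 2 * g0 * s + g1)
    (q0 * t ^+ 3 + q1 * s * t ^+ 2 + q2 * t ^+ 2 + q3 * s ^+ 2 * t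
     + q4 * s * t + q5 * t + g0 * s ^+ 2 + g1 * s + g2).

Lemma movey_pullback (s t : K) v :
  pullback_lin
    (mx3 [:: 1; s; 0] [:: 0; 1; 0] [:: 0; t; 1]) v (movey s t v).
Proof. by pullback_lin_tac v. Qed.

Lemma good_movey (s t : K) v : good (om (movey s t v)) -> good (om v).
Proof.
apply: (good_pullback_lin
  (N := mx3 [:: 1; - s; 0] [:: 0; 1; 0] [:: 0; - t; 1]));
  last exact: movey_pullback.
by mx3_tac.
Qed.

(** Fixes (0:0:1), preserves the line y = 0 and moves (1:0:t) to (1:0:0). *)
Definition movex (t : K) (v : vf) : vf :=
  let: VF p0 p1 p2 p3 p4 p5 q0 q1 q2 q3 q4 q5 g0 g1 g2 := v in
  VF
    p0 (3 * p0 * t + p1) p2 (3 * p0 * t ^+ 2 + 2 * p1 * t + p3)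
    (2 * p2 * t + p4) p5
    q0 (2 * q0 * t + q1) (q2 + p0 * t) (q0 * t ^+ 2 + q1 * t + q3)
    (q2 * t + q4 + 2 * p0 * t ^+ 2 + p1 * t) (q5 + p2 * t)
    (g0 + p0 * t ^+ 3 + p1 * t ^+ 2 + p3 * t) (g1 + p2 * t ^+ 2 + p4 * t)
    (g2 + p5 * t).

Lemma movex_pullback (t : K) v :
  pullback_lin
    (mx3 [:: 1; 0; 0] [:: 0; 1; 0] [:: t; 0; 1]) v (movex t v).
Proof. by pullback_lin_tac v. Qed.

Lemma good_movex (t : K) v : good (om (movex t v)) -> good (om v).
Proof.
apply: (good_pullback_lin
  (N := mx3 [:: 1; 0; 0] [:: 0; 1; 0] [:: - t; 0; 1]));
  last exact: movex_pullback.
by mx3_tac.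
Qed.

(** The translation of the chart z = 1 that moves (s:t:1) to (0:0:1). *)
Definition movez (s t : K) (v : vf) : vf :=
  let: VF p0 p1 p2 p3 p4 p5 q0 q1 q2 q3 q4 q5 g0 g1 g2 := v in
  VF
    (p0 + p1 * s + p2 * t + p3 * s ^+ 2 + p4 * s * t + p5 * t ^+ 2
     + g0 * s ^+ 3 + g1 * s ^+ 2 * t + g2 * s * t ^+ 2)
    (p1 + 2 * p3 * s + p4 * t + 3 * g0 * s ^+ 2 + 2 * g1 * s * t
     + g2 * t ^+ 2)
    (p2 + p4 * s + 2 * p5 * t + g1 * s ^+ 2 + 2 * g2 * s * t)
    (p3 + 3 * g0 * s + g1 * t) (p4 + 2 * g1 * s + 2 * g2 * t) (p5 + g2 * s)
    (q0 + q1 * s + q2 * t + q3 * s ^+ 2 + q4 * s * t + q5 * t ^+ 2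
     + g0 * s ^+ 2 * t + g1 * s * t ^+ 2 + g2 * t ^+ 3)
    (q1 + 2 * q3 * s + q4 * t + 2 * g0 * s * t + g1 * t ^+ 2)
    (q2 + q4 * s + 2 * q5 * t + g0 * s ^+ 2 + 2 * g1 * s * t
     + 3 * g2 * t ^+ 2)
    (q3 + g0 * t) (q4 + 2 * g0 * s + 2 * g1 * t) (q5 + g1 * s + 3 * g2 * t)
    g0 g1 g2.

Lemma movez_pullback (s t : K) v :
  pullback_lin
    (mx3 [:: 1; 0; s] [:: 0; 1; t] [:: 0; 0; 1]) v (movez s t v).
Proof. by pullback_lin_tac v. Qed.

Lemma good_movez (s t : K) v : good (om (movez s t v)) -> good (om v).
Proof.
apply: (good_pullback_lin
  (N := mx3 [:: 1; 0; - s] [:: 0; 1; - t] [:: 0; 0; 1]));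
  last exact: movez_pullback.
by mx3_tac.
Qed.

End ElementaryMoves.

(** * Three families of foliations with a cubic common factor *)

Section TerminalCases.
Variable K : fieldType.
Local Notation x := ('X_i0 : {mpoly K[3]}).
Local Notation y := ('X_i1 : {mpoly K[3]}).
Local Notation z := ('X_i2 : {mpoly K[3]}).

(* The inverse of rho has base points (0:1:0), (0:0:1) and the direction y = 0 at the
   latter; the inverse of tau s has base point (0:0:1) and two points infinitely near to
   it, on the conic y z = s x^2. *)
Definition rho : mtriple K := [tuple x * y; y ^+ 2; x * z].
Definition rho_inv : mtriple K := [tuple x ^+ 2; x * y; y * z].
Definition tau (s : K) : mtriple K := [tuple x * y; y ^+ 2; y * z + s%:MP * x ^+ 2].

(** A nonconstant common divisor would divide a monomial, so some variable would divide it and hence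
    all components. *)
Lemma reduced_mon (phi : mtriple K) j s :
    tnth phi j = mon K s -> (forall i, exists k, tnth phi k \mPo kill K i != 0) ->
  no_common_factor phi.
Proof.
move=> Ej ni g gphi; have := gphi j; rewrite Ej => /mdvd_mon[] // [i ig].
have [k /negP[]] := ni i; apply/eqP/mdvdX_kill.
exact: mdvd_trans ig (gphi k).
Qed.

Ltac comp_tac :=
  rewrite ?(tnth_nth 0) /= ?(rmorphD, rmorphM, rmorphXn) /= ?comp_mpolyC
    ?comp_mpolyXU /=.

Lemma comp_kill i j :
  'X_j \mPo kill K i = if j == i then 0 else 'X_j.
Proof. by rewrite comp_mpolyXU -tnth_nth tnth_mktuple. Qed.

Ltac kill_tac :=
  rewrite (tnth_nth 0) /= ?(rmorphD, rmorphM, rmorphXn) /= ?comp_mpolyC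
    ?comp_kill /= ?mul0r ?add0r; do ?[apply: mulf_neq0 | apply: expf_neq0];
  by rewrite ?mpolyC_eq0 ?mpolyXU_neq0.

Lemma rho_reduced : no_common_factor rho.
Proof.
apply: (@reduced_mon _ i1 [:: i1; i1]).
  by rewrite (tnth_nth 0) /= /mon !big_cons big_nil mulr1.
apply: forall3; [exists i1 | exists i2 | exists i1]; kill_tac.
Qed.

Lemma rho_inv_reduced : no_common_factor rho_inv.
Proof.
apply: (@reduced_mon _ i0 [:: i0; i0]).
  by rewrite (tnth_nth 0) /= /mon !big_cons big_nil mulr1.
apply: forall3; [exists i2 | exists i0 | exists i0]; kill_tac.
Qed.

Lemma tau_reduced s : s != 0 -> no_common_factor (tau s).
Proof.
move=> s0; apply: (@reduced_mon _ i1 [:: i1; i1]).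
  by rewrite (tnth_nth 0) /= /mon !big_cons big_nil mulr1.
apply: forall3; [exists i1 | exists i2 | exists i1]; kill_tac.
Qed.

Lemma dhomog_mulXX i j : ('X_i * 'X_j : {mpoly K[3]}) \is 2.-homog.
Proof.
have X1 l : ('X_l : {mpoly K[3]}) \is 1.-homog by rewrite dhomogX /= mdeg1.
exact: dhomogM (X1 i) (X1 j).
Qed.

Ltac homog_tac :=
  apply: forall3; rewrite (tnth_nth 0) /= ?expr2; do ?apply: rpredD;
  rewrite ?mul_mpolyC; try apply: dhomogZ; exact: dhomog_mulXX.

Lemma rho_homog : homog_triple 2 rho. Proof. homog_tac. Qed.
Lemma rho_inv_homog : homog_triple 2 rho_inv. Proof. homog_tac. Qed.
Lemma tau_homog s : homog_triple 2 (tau s). Proof. homog_tac. Qed.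

Ltac cremona_tac :=
  apply: forall3; rewrite /mon !big_cons big_nil; comp_tac; ring.

Lemma good_rho v (r : seq 'I_3) (W0 : mtriple K) : size r = 3 ->
    (forall j, tnth (pullback_form rho (om v)) j = mon K r * tnth W0 j) ->
  good (om v).
Proof.
move=> sr EW.
apply: (good_monomial_cremona (s := [:: i0; i0; i1]) (s' := [:: i0; i1; i1])
  (s'' := [:: i0; i1; i0; i1; i1; i1]) (om_homog v) (om_euler v) rho_homog
  rho_reduced rho_inv_homog rho_inv_reduced sr _ _ _ EW); try cremona_tac.
by rewrite /mon !big_cons !big_nil; comp_tac; ring.
Qed.

(** [tau (- s)] is the inverse of [tau s]; both composites carry the factor y^3. *)
Lemma good_tau s v (W0 : mtriple K) : s != 0 ->
    (forall j, tnth (pullback_form (tau s) (om v)) j =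
       mon K [:: i1; i1; i1] * tnth W0 j) ->
  good (om v).
Proof.
move=> s0 EW; have s0' : - s != 0 by rewrite oppr_eq0.
apply: (good_monomial_cremona (s := [:: i1; i1; i1]) (s' := [:: i1; i1; i1])
  (s'' := [:: i1; i1; i1; i1; i1; i1]) (r := [:: i1; i1; i1]) (om_homog v)
  (om_euler v) (tau_homog s) (tau_reduced s0) (tau_homog (- s)) (tau_reduced s0')
  erefl _ _ _ EW); try cremona_tac.
by rewrite /mon !big_cons !big_nil; comp_tac; ring.
Qed.

Ltac pullback_tac :=
  apply: forall3; rewrite tnth_mktuple sum3 !om_comp !(tnth_nth 0) /form /=
    !(mderivD, mderiv_mulC, mderivM, mderivXU, expr2) /mon !big_cons big_nil
    /quad !(tnth_nth 0) /=; ring.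

(** Composed with [rho], the polynomials P, Q, g of [form] become y^2 P1, y^3 Q1, y^2 g, which
    yields the factor y^3. *)
Lemma good_nilpotent (p2 p3 p4 p5 q4 q5 g0 g1 g2 : K) :
  good (om (VF 0 0 p2 p3 p4 p5 0 0 0 0 q4 q5 g0 g1 g2)).
Proof.
pose c (a : K) := a%:MP_[3].
pose P1 := c p2 * x * z + c p3 * x ^+ 2 + c p4 * x * y + c p5 * y ^+ 2.
pose Q1 := c q4 * x + c q5 * y.
pose g := c g0 * x ^+ 2 + c g1 * x * y + c g2 * y ^+ 2.
apply: (@good_rho _ [:: i1; i1; i1] [tuple y * (y * g + z * P1);
  x * (x * z * Q1 - y * g - 2%:R * z * P1); x * y * (P1 - x * Q1)]) => //.
rewrite /P1 /Q1 /g /c; pullback_tac.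
Qed.

(** Composed with [rho], P, Q and the quadratic form become x y P1, y^2 Q1 and x y^2 g, which yields
    the factor x y^2. *)
Lemma good_eigen_sing (p1 p2 p3 p4 q2 q3 q4 q5 g0 g1 : K) :
  good (om (VF 0 p1 p2 p3 p4 0 0 0 q2 q3 q4 q5 g0 g1 0)).
Proof.
pose c (a : K) := a%:MP_[3].
pose P1 := c p1 * x * z + c p2 * y * z + c p3 * x * y + c p4 * y ^+ 2.
pose Q1 := c q2 * x * z + c q3 * x ^+ 2 + c q4 * x * y + c q5 * y ^+ 2.
pose g := c g0 * x + c g1 * y.
apply: (@good_rho _ [:: i0; i1; i1] [tuple y * (y ^+ 2 * g + z * P1);
  x * (z * Q1 - y ^+ 2 * g - 2%:R * z * P1); x * y * (P1 - Q1)]) => //.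
rewrite /P1 /Q1 /g /c; pullback_tac.
Qed.

(** The coefficient of x^2 in Q makes the conic y z = s x^2 osculate the foliation at (0:0:1). It
    makes x Q1 - 2 P1 divisible by y, which supplies the third factor y. *)
Lemma good_eigen_eigen (p1 p2 p3 p4 p5 q2 s q4 q5 g0 g1 g2 : K) : s != 0 ->
  good (om (VF 0 p1 p2 p3 p4 p5 0 0 q2 ((2%:R * p1 - q2) * s) q4 q5 g0 g1 g2)).
Proof.
pose c (a : K) := a%:MP_[3].
pose Z := y * z + c s * x ^+ 2.
pose S := c p1 * x * z + c p2 * Z + c p3 * x ^+ 2 + c p4 * x * y + c p5 * y ^+ 2.
pose R := c q2 * z + c q4 * x + c q5 * y.
pose P1 := c p1 * c s * x ^+ 3 + y * S.
pose Q1 := 2%:R * c p1 * c s * x ^+ 2 + y * R.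
pose g := c g0 * x ^+ 2 + c g1 * x * y + c g2 * y ^+ 2.
move=> s0; apply: (@good_tau s _ [tuple
  Z * Q1 + y ^+ 2 * g + 2%:R * c s * x * (P1 - x * Q1);
  Z * (x * R - 2%:R * S) - x * y * g + z * (P1 - x * Q1);
  y * (P1 - x * Q1)]) => //.
rewrite /P1 /Q1 /S /R /Z /g /c; pullback_tac.
Qed.

End TerminalCases.

(** * Singular points *)

Section SingularPoints.
Variable K : numClosedFieldType.
Implicit Types (v : vf K) (a b c s t : K).

Definition pt a b c : 'I_3 -> K := fun i => nth 0 [:: a; b; c] i.

Ltac sing_tac M :=
  apply: (sing_pullback_lin M); apply: forall3; rewrite sum3 !mxE /pt /=; ring.

Lemma sing_shear t v a b c :
  sing v (pt a b c) -> sing (shear t v) (pt a (b - t * a) c).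
Proof. sing_tac (shear_pullback t v). Qed.

Lemma sing_swapxy v a b c : sing v (pt a b c) -> sing (swapxy v) (pt b a c).
Proof. sing_tac (swapxy_pullback v). Qed.

Lemma sing_swapxz v a b c : sing v (pt a b c) -> sing (swapxz v) (pt c b a).
Proof. sing_tac (swapxz_pullback v). Qed.

Lemma sing_movey s t v a b c :
  sing v (pt a b c) -> sing (movey s t v) (pt (a - s * b) b (c - t * b)).
Proof. sing_tac (movey_pullback s t v). Qed.

Lemma sing_movex t v a b c :
  sing v (pt a b c) -> sing (movex t v) (pt a b (c - t * a)).
Proof. sing_tac (movex_pullback t v). Qed.

Lemma sing_movez s t v a b c :
  sing v (pt a b c) -> sing (movez s t v) (pt (a - s * c) (b - t * c) c).
Proof. sing_tac (movez_pullback s t v). Qed.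

Lemma cube_mul_eq0 a b : b != 0 -> b * (a * b ^+ 2) = 0 -> a = 0.
Proof.
by move=> b0 /eqP; rewrite !mulf_eq0 (negbTE b0) !orbF => /eqP.
Qed.

Lemma singE p0 p1 p2 p3 p4 p5 q0 q1 q2 q3 q4 q5 g0 g1 g2 a b c :
  sing (VF p0 p1 p2 p3 p4 p5 q0 q1 q2 q3 q4 q5 g0 g1 g2) (pt a b c) <->
  let P := quad p0 p1 p2 p3 p4 p5 a b c in
  let Q := quad q0 q1 q2 q3 q4 q5 a b c in
  let g := g0 * a ^+ 2 + g1 * a * b + g2 * b ^+ 2 in
  [/\ c * Q + b * g = 0, c * P + a * g = 0 & b * P - a * Q = 0].
Proof.
split=> [sX|[E0 E1 E2]]; last by apply: forall3; rewrite // /form /= [X in - X]E1 oppr0.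
split; [exact: (sX i0) | | exact: (sX i2)].
by apply: oppr_inj; rewrite oppr0; apply: (sX i1).
Qed.

Lemma sing_e3 v c : c != 0 -> sing v (pt 0 0 c) -> cp0 v = 0 /\ cq0 v = 0.
Proof.
case: v => p0 p1 p2 p3 p4 p5 q0 q1 q2 q3 q4 q5 g0 g1 g2 c0 /singE /=.
rewrite /quad => -[E0 E1 _].
by split; apply: (cube_mul_eq0 c0); [apply: etrans E1 | apply: etrans E0]; ring.
Qed.

Lemma sing_e2 v b : b != 0 -> sing v (pt 0 b 0) -> cp5 v = 0 /\ cg2 v = 0.
Proof.
case: v => p0 p1 p2 p3 p4 p5 q0 q1 q2 q3 q4 q5 g0 g1 g2 b0 /singE /=.
rewrite /quad => -[E0 _ E2].
by split; apply: (cube_mul_eq0 b0); [apply: etrans E2 | apply: etrans E0]; ring.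
Qed.

Lemma sing_e1 v a : a != 0 -> sing v (pt a 0 0) -> cg0 v = 0 /\ cq3 v = 0.
Proof.
case: v => p0 p1 p2 p3 p4 p5 q0 q1 q2 q3 q4 q5 g0 g1 g2 a0 /singE /=.
rewrite /quad => -[_ E1 E2].
split; apply: (cube_mul_eq0 a0); first by apply: etrans E1; ring.
by apply: oppr_inj; rewrite oppr0; apply: etrans E2; ring.
Qed.

Lemma nilpotent_good v :
    cp0 v = 0 -> cp1 v = 0 -> cq0 v = 0 -> cq1 v = 0 -> cq2 v = 0 -> cq3 v = 0 ->
  good (om v).
Proof. by case: v => /= *; subst; apply: good_nilpotent. Qed.

Lemma eigen_sing_good v :
    cp0 v = 0 -> cq0 v = 0 -> cq1 v = 0 -> cp5 v = 0 -> cg2 v = 0 ->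
  good (om v).
Proof. by case: v => /= *; subst; apply: good_eigen_sing. Qed.

(** Absence of resonance allows q3 = (2 p1 - q2) s to be solved for the parameter of the osculating
    conic. *)
Lemma eigen_eigen_good v :
    cp0 v = 0 -> cq0 v = 0 -> cq1 v = 0 -> cq3 v != 0 -> cq2 v != 2%:R * cp1 v ->
  good (om v).
Proof.
case: v => p0 p1 p2 p3 p4 p5 q0 q1 q2 q3 q4 q5 g0 g1 g2 /= -> -> -> q30 ne.
have d0 : 2%:R * p1 - q2 != 0 by rewrite subr_eq0 eq_sym.
rewrite (_ : q3 = (2%:R * p1 - q2) * (q3 / (2%:R * p1 - q2))); last by field.
by apply: good_eigen_eigen; rewrite mulf_neq0 ?invr_eq0.
Qed.

Lemma sing_off_eigenline_good v a b c :
    cp0 v = 0 -> cq0 v = 0 -> cq1 v = 0 -> b != 0 -> sing v (pt a b c) ->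
  good (om v).
Proof.
move=> p00 q00 q10 b0 sv; apply: (good_movey (s := a / b) (t := c / b)).
have := sing_movey (a / b) (c / b) sv.
rewrite !divfK // !subrr => /(sing_e2 b0)[p50 g20].
apply: eigen_sing_good => //; case: v {sv p50 g20} p00 q00 q10 => /= *; subst; ring.
Qed.

(** The equation for [t] makes x = t y an eigendirection with eigenvalue q2. Bringing it to y = 0
    exchanges the eigenvalues, up to the sign due to orientation. *)
Lemma other_eigenline v t :
    cp0 v = 0 -> cq0 v = 0 -> cq1 v = 0 -> (cq2 v - cp1 v) * t = cp2 v ->
  let v' := shear t (swapxy v) in
  [/\ cp0 v' = 0, cq0 v' = 0, cq1 v' = 0, cp1 v' = - cq2 v & cq2 v' = - cp1 v].
Proof.
by case: v => /= *; subst; split; rewrite ?mulr0; ring.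
Qed.

(* In the next lemmas the points (0:0:1) and (1:0:0) are singular and the line y = 0
   through them is invariant. *)
Lemma two_sing_good_of_eigen v t :
    cp0 v = 0 -> cq0 v = 0 -> cq1 v = 0 -> cq3 v = 0 -> cg0 v = 0 ->
    (cq2 v - cp1 v) * t = cp2 v ->
  good (om v).
Proof.
move=> p00 q00 q10 q30 g00 Et; apply: good_swapxy; apply: (good_shear (t := t)).
have [E1 E2 E3 _ _] := other_eigenline p00 q00 q10 Et.
(* The original point (1:0:0) lies off the line x = t y. *)
apply: (sing_off_eigenline_good (a := 0) (b := 1) (c := 0)); rewrite ?oner_eq0 //.
have sv : sing v (pt 1 0 0).
  case: v p00 q00 q10 q30 g00 {Et E1 E2 E3} => /= *; subst.
  by apply/singE; rewrite /quad; split; ring.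
by have := sing_shear t (sing_swapxy sv); rewrite mulr0 subr0.
Qed.

Lemma two_sing_good_of_neq v :
    cp0 v = 0 -> cq0 v = 0 -> cq1 v = 0 -> cq3 v = 0 -> cg0 v = 0 ->
    cq2 v != cp1 v ->
  good (om v).
Proof.
move=> p00 q00 q10 q30 g00 ne.
apply: (two_sing_good_of_eigen (t := cp2 v / (cq2 v - cp1 v))) => //.
by rewrite mulrC divfK // subr_eq0.
Qed.

Lemma two_sing_good v :
    cp0 v = 0 -> cq0 v = 0 -> cq1 v = 0 -> cq3 v = 0 -> cg0 v = 0 -> good (om v).
Proof.
move=> p00 q00 q10 q30 g00.
have [Epq|] := eqVneq (cq2 v) (cp1 v); last exact: two_sing_good_of_neq.
have [p10|p10] := eqVneq (cp1 v) 0.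
  by apply: nilpotent_good => //; rewrite Epq.
have swz : [/\ cp0 (swapxz v) = 0, cq0 (swapxz v) = 0, cq1 (swapxz v) = 0,
    cq3 (swapxz v) = 0 & cg0 (swapxz v) = 0].
  by case: v p00 q00 q10 q30 g00 {Epq p10} => /= *; subst; rewrite oppr0.
case: swz => p00' q00' q10' q30' g00'.
(* After [swapxz], the diagonal entries of the linear part at the former point (1:0:0) are p3 and p3
   - q4. *)
have [q40|q40] := eqVneq (cq4 v) 0; last first.
  apply: good_swapxz; apply: two_sing_good_of_neq => //.
  case: v q40 {Epq p10 p00 q00 q10 q30 g00 p00' q00' q10' q30' g00'} => /= *.
  by rewrite -subr_eq0 addrAC subrr add0r oppr_eq0.
have [p30|p30] := eqVneq (cp3 v) 0.
  apply: good_swapxz; apply: nilpotent_good => //;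
  by case: v p30 q40 {Epq p10 p00 q00 q10 q30 g00 p00' q00' q10' q30' g00'} => /= *;
    subst; rewrite ?subrr.
(* The invariant line has a third singular point (-p1:0:p3), where the eigenvalues -p1 and p1 are
   distinct. *)
apply: (good_movez (s := - cp1 v / cp3 v) (t := 0)).
case: v p00 q00 q10 q30 g00 Epq p10 q40 p30 {p00' q00' q10' q30' g00'}.
move=> p0 p1 p2 p3 p4 p5 q0 q1 q2 q3 q4 q5 g0 g1 g2 /=.
move=> -> -> -> -> -> -> p10 -> p30; apply: two_sing_good_of_neq => /=; try by field.
have -> : p1 + 2%:R * p3 * (- p1 / p3) = - p1 by field.
by rewrite -subr_eq0 (_ : _ - _ = p1 *+ 2) ?mulrn_eq0 //; ring.
Qed.

End SingularPoints.

(** * Roots of polynomials and elimination *)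

Section PolynomialRoots.
Variable K : closedFieldType.
Implicit Types (p q : {poly K}).

(* p has degree at most n, and the coefficient of its term of degree n is a, which
   may vanish. *)
Definition top p n (a : K) := (size p <= n.+1)%N /\ p`_n = a.

Lemma topC (c : K) : top c%:P 0 c.
Proof. by split; [exact: size_polyC_leq1 | rewrite coefC]. Qed.

Lemma topX : top 'X 1 1.
Proof. by split; [rewrite size_polyX | rewrite coefX]. Qed.

Lemma top_Poly (s : seq K) n : (size s <= n.+1)%N -> top (Poly s) n s`_n.
Proof. by split; [exact: leq_trans (size_Poly s) _ | rewrite coef_Poly]. Qed.

Lemma topW p n a : top p n a -> top p n.+1 0.
Proof. by move=> [sp _]; split; [exact: leqW | exact: nth_default]. Qed.

Lemma topD p q n a b : top p n a -> top q n b -> top (p + q) n (a + b).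
Proof.
move=> [sp <-] [sq <-]; split; last by rewrite coefD.
by rewrite (leq_trans (size_polyD _ _)) // geq_max sp.
Qed.

Lemma topN p n a : top p n a -> top (- p) n (- a).
Proof. by move=> [sp <-]; split; rewrite ?size_polyN ?coefN. Qed.

Lemma topM p q m n a b : top p m a -> top q n b -> top (p * q) (m + n) (a * b).
Proof.
move=> [sp <-] [sq <-]; split.
  rewrite (leq_trans (size_polyMleq _ _)) // -ltnS.
  have [->|] := posnP (size p + size q)%N; first by [].
  by move=> /prednK ->; rewrite -addnS -addSn leq_add.
rewrite coefM (bigD1 (inord m : 'I_(m + n).+1)) //= inordK ?ltnS ?leq_addr //.
rewrite addKn big1 ?addr0 // => i ne_im.
have [lt|gt|eq] := ltngtP (i : nat) m.
- rewrite [q`__]nth_default ?mulr0 // (leq_trans sq) //.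
  by rewrite ltn_subRL ltn_add2r.
- by rewrite nth_default ?mul0r // (leq_trans sp).
- by case/eqP: ne_im; apply: val_inj; rewrite /= inordK ?eq // ltnS leq_addr.
Qed.

Lemma top_root p n a : top p n.+1 a -> a != 0 -> exists x, p.[x] = 0.
Proof.
move=> [sp <-] nz; have /closed_rootP[x /rootP px] : size p != 1.
  apply: contraNneq nz => sp1; rewrite nth_default // sp1 //.
by exists x.
Qed.

(** [horner_rec] on a list of coefficients, constant term first, lets the equation unfold by
    computation. *)
Lemma root_list (s : seq K) n :
  size s = n.+2 -> s`_n.+1 != 0 -> exists x, horner_rec s x = 0.
Proof.
move=> sE; have := @top_Poly s n.+1; rewrite sE leqnn => /(_ isT)/top_root h /h [x].
by rewrite horner_Poly => E; exists x.
Qed.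

(* p0 times the first hypothesis is the resultant in w of the two equations. *)
Lemma common_root (p0 t u a b d g : K) (rho := p0 * g - u * d)
    (sigma := p0 * b - u * a) (tau := b * d - a * g) : p0 != 0 ->
    rho * rho + sigma * tau +
    t * (3%:R * (p0 * (u * (b * g))) - u * (u * (b * d)) - p0 * (b * (b * b)) -
       2%:R * (u * (u * (a * g))) + u * (a * (b * b))) +
      t * t * (u * (u * u)) * g = 0 ->
  exists w, p0 * w ^+ 2 + (a - t * u) * w + (d - t * b) = 0 /\
    u * w ^+ 2 + b * w + g = 0.
Proof.
move=> p00 ER.
(* [al * w + be] is [p0] times the second equation minus [u] times the first. If [al] vanishes, the
   resultant forces [be = 0]; otherwise [w] is determined. *)
pose al := p0 * b - u * (a - t * u); pose be := p0 * g - u * (d - t * b).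
have ERes : p0 * be ^+ 2 - (a - t * u) * al * be + (d - t * b) * al ^+ 2 = 0.
  by rewrite -[RHS](mulr0 p0) -ER /al /be /rho /sigma /tau; ring.
have second w : p0 * w ^+ 2 + (a - t * u) * w + (d - t * b) = 0 ->
    al * w + be = 0 -> u * w ^+ 2 + b * w + g = 0.
  move=> E1 E2; apply: (mulfI p00).
  rewrite mulr0 -[RHS](mulr0 u) -[in RHS]E1 -[LHS]subr0 -E2 /al /be; ring.
have [al0|al0] := eqVneq al 0.
  have be0 : be = 0.
    have := ERes; rewrite al0 mulr0 mul0r expr0n mulr0 subr0 addr0 => /eqP.
    by rewrite mulf_eq0 (negbTE p00) expf_eq0 /= => /eqP.
  have [w Ew] := @root_list [:: d - t * b; a - t * u; p0] 1 erefl p00.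
  have {}Ew : p0 * w ^+ 2 + (a - t * u) * w + (d - t * b) = 0.
    by rewrite -[RHS]Ew /=; ring.
  by exists w; split=> //; apply: second; rewrite // al0 be0 mul0r addr0.
have Ew : p0 * (- be / al) ^+ 2 + (a - t * u) * (- be / al) + (d - t * b) = 0.
  apply: (mulfI (expf_neq0 2 al0)); rewrite mulr0 -[RHS]ERes; field.
  exact: al0.
exists (- be / al); split=> //; apply: second => //; field.
exact: al0.
Qed.

End PolynomialRoots.

(** * Case analysis over all foliations of degree 2 *)

Section EveryFoliation.
Variable K : numClosedFieldType.
Implicit Types (v : vf K) (a b c s t : K).

(** The direction x = 0 serves if p2 = 0, otherwise y = t x with [t] a root of a quadratic equation.
    The last clause keeps track of a second singular point. *)
Lemma exists_eigenline v : cp0 v = 0 -> cq0 v = 0 ->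
  exists v', [/\ cp0 v' = 0, cq0 v' = 0, cq1 v' = 0, good (om v') -> good (om v) &
    forall a b c, sing v (pt a b c) -> (a != 0) || (b != 0) ->
      exists a' b', sing v' (pt a' b' c) /\ (a' != 0) || (b' != 0)].
Proof.
move=> p00 q00; have [p20|p20] := eqVneq (cp2 v) 0.
  exists (swapxy v); split; [ | | |exact: good_swapxy|];
    try by case: v p00 q00 p20 => /= *; subst; rewrite oppr0.
  by move=> a b c sv ab; exists b, a; rewrite orbC; split; first exact: sing_swapxy.
have [|t Et] := @root_list _ [:: cq1 v; cq2 v - cp1 v; - cp2 v] 1 erefl.
  by rewrite oppr_eq0.
exists (shear t v); split; last 2 first.
- exact: good_shear.
- move=> a b c sv ab; exists a, (b - t * a); split; first exact: sing_shear.
  by move: ab; case: eqVneq => [->|//]; rewrite mulr0 subr0.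
- by case: v p00 q00 {p20 Et} => /= *; subst.
- by case: v p00 q00 {p20 Et} => /= *; subst; rewrite mul0r subr0.
move: Et; case: v {p00 q00 p20} => ? ? ? ? ? ? ? ? ? ? ? ? ? ? ? /= Et.
by rewrite -[RHS]Et; ring.
Qed.

(** If the second singular point is on the line y = 0, moving it to (1:0:0) shows that the line is
    invariant. *)
Lemma other_sing_eigen_good v a b c :
    cp0 v = 0 -> cq0 v = 0 -> cq1 v = 0 -> sing v (pt a b c) ->
    (a != 0) || (b != 0) -> good (om v).
Proof.
move=> p00 q00 q10 sv; have [b0|b0 _] := eqVneq b 0; last first.
  exact: sing_off_eigenline_good b0 sv.
rewrite orbF => a0; apply: (good_movex (t := c / a)).
have := sing_movex (c / a) sv; rewrite divfK // subrr b0 => /(sing_e1 a0)[g00 q30].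
apply: two_sing_good => //; case: v p00 q00 q10 {sv g00 q30} => /= *; subst;
  by rewrite ?mulr0 ?mul0r ?addr0.
Qed.

Lemma other_sing_good v a b c :
    cp0 v = 0 -> cq0 v = 0 -> sing v (pt a b c) -> (a != 0) || (b != 0) ->
  good (om v).
Proof.
move=> p00 q00 sv ab; have [v' [p00' q00' q10' gv h]] := exists_eigenline p00 q00.
have [a' [b' [sv' ab']]] := h _ _ _ sv ab.
exact/gv/(other_sing_eigen_good p00' q00' q10' sv' ab').
Qed.

(** If q3 = 0 the line y = 0 is invariant, and since p1 is nonzero the singular points (1:0:z) on it
    are the roots of a genuine quadratic. *)
Lemma nonresonant_good v :
    cp0 v = 0 -> cq0 v = 0 -> cq1 v = 0 -> cp1 v != 0 -> cq2 v != 2%:R * cp1 v ->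
  good (om v).
Proof.
move=> p00 q00 q10 p10 ne; have [q30|q30] := eqVneq (cq3 v) 0; last first.
  exact: eigen_eigen_good.
have [z Ez] := @root_list _ [:: cg0 v; cp3 v; cp1 v] 1 erefl p10.
apply: (other_sing_eigen_good (a := 1) (b := 0) (c := z)); rewrite ?oner_eq0 //.
case: v p00 q00 q10 q30 Ez {p10 ne} => ? ? ? ? ? ? ? ? ? ? ? ? ? ? ? /= -> -> -> -> Ez.
by apply/singE; rewrite /quad; split; [ring | rewrite -[RHS]Ez; ring | ring].
Qed.

(* As p2 != 0, each line x = t y through (0:0:1) is tangent to the foliation at exactly
   one further point, which is singular if t is a root of a polynomial of degree 5. *)
Lemma cusp_good v :
    cp0 v = 0 -> cq0 v = 0 -> cq1 v = 0 -> cp1 v = 0 -> cq2 v = 0 ->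
    cp2 v != 0 -> cq3 v != 0 -> good (om v).
Proof.
case: v => p0 p1 p2 p3 p4 p5 q0 q1 q2 q3 q4 q5 g0 g1 g2 /=.
move=> -> -> -> -> -> p20 q30.
have [HP HQ Hg] : [/\ top (Poly [:: p5; p4; p3]) 2 p3,
   top (Poly [:: q5; q4; q3]) 2 q3 & top (Poly [:: g2; g1; g0]) 2 g0].
  by split; apply: top_Poly.
have HC := topD (topW HP) (topN (topM (topX K) HQ)).
(* This is - C Q + p2 g as a polynomial in t; its leading coefficient in degree 5 is q3^2. *)
have HR := topD (topN (topM HC HQ)) (topW (topW (topW (topM (topC p2) Hg)))).
have [|t] := top_root HR.
  by rewrite add0r mul1r addr0 mulNr opprK mulf_neq0.
rewrite !(hornerD, hornerN, hornerM, hornerC, hornerX, horner_Poly) /= => Et.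
pose C := p3 * t ^+ 2 + p4 * t + p5 - t * (q3 * t ^+ 2 + q4 * t + q5).
apply: (other_sing_good (a := t) (b := 1) (c := - C / p2)); rewrite ?oner_eq0 ?orbT //.
have E0 : - C / p2 * (q3 * t ^+ 2 + q4 * t + q5) + (g0 * t ^+ 2 + g1 * t + g2) = 0.
  by apply: (mulfI p20); rewrite mulr0 -[RHS]Et /C; field.
have E2 : p2 * (- C / p2) + p3 * t ^+ 2 + p4 * t + p5 -
    t * (q3 * t ^+ 2 + q4 * t + q5) = 0.
  by rewrite /C; field.
apply/singE; rewrite /quad; split.
- by rewrite -[RHS]E0; ring.
- move: (- C / p2) E0 E2 => w E0 E2.
  have := congr2 (fun i j => w * i + t * j) E2 E0.
  by rewrite /= !mulr0 addr0; apply: etrans; ring.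
- by rewrite -[RHS]E2; ring.
Qed.

Lemma other_eigen_nonresonant_good v t :
    cp0 v = 0 -> cq0 v = 0 -> cq1 v = 0 -> (cq2 v - cp1 v) * t = cp2 v ->
    cq2 v != 0 -> cp1 v != 2%:R * cq2 v -> good (om v).
Proof.
move=> p00 q00 q10 Et q20 ne; apply: good_swapxy; apply: (good_shear (t := t)).
have [p00' q00' q10' p1E q2E] := other_eigenline p00 q00 q10 Et.
by apply: nonresonant_good; rewrite // ?p1E ?q2E ?oppr_eq0 // mulrN eqr_opp.
Qed.

(** The eigenvalues are p1, belonging to y = 0, and q2. If p1 is zero or resonant the other
    eigendirection is used; if both vanish the linear part is nilpotent. *)
Lemma vertex_eigen_good v :
  cp0 v = 0 -> cq0 v = 0 -> cq1 v = 0 -> good (om v).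
Proof.
move=> p00 q00 q10.
have [p10|p10] := eqVneq (cp1 v) 0; last first.
  have [q2E|] := eqVneq (cq2 v) (2%:R * cp1 v); last exact: nonresonant_good.
  apply: (other_eigen_nonresonant_good (t := cp2 v / cp1 v)) => //.
  - by rewrite q2E; field.
  - by rewrite q2E mulf_neq0 // pnatr_eq0.
  (* Resonance in both directions would give p1 = 4 p1. *)
  - rewrite q2E -subr_eq0 (_ : _ - _ = - (cp1 v *+ 3)); last by ring.
    by rewrite oppr_eq0 mulrn_eq0.
have [q20|q20] := eqVneq (cq2 v) 0; last first.
  apply: (other_eigen_nonresonant_good (t := cp2 v / cq2 v)) => //.
  - by rewrite p10; field.
  - by rewrite p10 eq_sym mulf_neq0 // pnatr_eq0.
have [q30|q30] := eqVneq (cq3 v) 0; first exact: nilpotent_good.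
have [p20|p20] := eqVneq (cp2 v) 0; last exact: cusp_good.
(* The linear part is zero, so every direction is an eigendirection; one is chosen that makes q3
   vanish after the move. *)
have [p50|p50] := eqVneq (cp5 v) 0.
  apply: good_swapxy; apply: nilpotent_good;
  by case: v p00 q00 q10 p10 q20 p20 p50 {q30} => /= *; subst; rewrite oppr0.
have [|t] := @root_list _ [:: cq3 v; cq4 v - cp3 v; cq5 v - cp4 v; - cp5 v] 2 erefl.
  by rewrite oppr_eq0.
move=> Et; apply: (good_shear (t := t)).
case: v p00 q00 q10 p10 q20 p20 Et {q30 p50} => ? ? ? ? ? ? ? ? ? ? ? ? ? ? ?.
move=> /= -> -> -> -> -> -> Et; apply: nilpotent_good => /=; try by ring.
by rewrite -[RHS]Et; ring.
Qed.

Lemma vertex_good v : cp0 v = 0 -> cq0 v = 0 -> good (om v).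
Proof.
move=> p00 q00; have [v' [p00' q00' q10' gv _]] := exists_eigenline p00 q00.
exact/gv/vertex_eigen_good.
Qed.

(** A translation moves the singular point to (0:0:1), after an exchange of coordinates if it lies
    on z = 0. *)
Lemma sing_good v a b c :
  sing v (pt a b c) -> (a != 0) || (b != 0) -> good (om v).
Proof.
have gen (w : vf K) a' b' c' : c' != 0 -> sing w (pt a' b' c') -> good (om w).
  move=> c0 sw; apply: (good_movez (s := a' / c') (t := b' / c')).
  have := sing_movez (a' / c') (b' / c') sw; rewrite !divfK // !subrr.
  by move/(sing_e3 c0) => [? ?]; apply: vertex_good.
move=> sv; have [c0|/gen h _] := eqVneq c 0; last exact: h sv.
have [a0|a0 _] := eqVneq a 0.
  move=> b0; apply/good_swapxy/good_swapxz.
  exact: gen b0 (sing_swapxz (sing_swapxy sv)).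
exact/good_swapxz/(gen _ _ _ _ a0 (sing_swapxz sv)).
Qed.

(* The line y = 0 is tangent to the foliation at (0:0:1).  The coefficient e below
   vanishes if and only if the line is invariant or its second point of tangency,
   (q1:0:-q3), is singular.  Otherwise eliminating w between the equations of the
   singular points (t:1:w) gives a polynomial in t of degree 7 with leading coefficient
   e. *)
Lemma exists_sing v : cq0 v = 0 -> cp0 v != 0 ->
  exists a b c, sing v (pt a b c) /\ (a != 0) || (b != 0).
Proof.
case: v => p0 p1 p2 p3 p4 p5 q0 q1 q2 q3 q4 q5 g0 g1 g2 /= -> p00.
pose e := q1 ^+ 3 * g0 - q1 ^+ 2 * q3 * p3 + q1 * q3 ^+ 2 * p1 - p0 * q3 ^+ 3.
have [e0|e0] := eqVneq e 0.
  have [q10|q10] := eqVneq q1 0; last first.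
    exists q1, 0, (- q3); split; last by rewrite q10.
    apply/singE; rewrite /quad; split; try ring.
    by rewrite -[RHS]e0 /e; ring.
  have q30 : q3 = 0.
    apply/eqP; move: e0; rewrite /e q10 => /eqP.
    rewrite (_ : _ - _ = - (p0 * q3 ^+ 3)); last by ring.
    by rewrite oppr_eq0 mulf_eq0 (negbTE p00) expf_eq0.
  have [z Ez] := @root_list _ [:: g0; p3; p1; p0] 2 erefl p00.
  exists 1, 0, z; rewrite oner_eq0; split=> //.
  apply/singE; rewrite /quad q10 q30.
  by split; [ring | rewrite -[RHS]Ez /=; ring | ring].
(* Degrees and leading coefficients in t of the ingredients of the resultant in [common_root],
   assembled in [HR]. *)
have [Hu Ha] : top (Poly [:: q2; q1]) 1 q1 /\ top (Poly [:: p2; p1]) 1 p1.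
  by split; apply: top_Poly.
have [Hb Hd Hg] : [/\ top (Poly [:: q5; q4; q3]) 2 q3,
   top (Poly [:: p5; p4; p3]) 2 p3 & top (Poly [:: g2; g1; g0]) 2 g0].
  by split; apply: top_Poly.
have Hp := topC p0; have H2 := topC (2%:R : K); have H3 := topC (3%:R : K).
have HX := topX K.
have Hrho := topD (topW (topM Hp Hg)) (topN (topM Hu Hd)).
have Hsig := topD (topM Hp Hb) (topN (topM Hu Ha)).
have Htau := topD (topM Hb Hd) (topN (topW (topM Ha Hg))).
have HE := topD (topD (topD (topD (topW (topM H3 (topM Hp (topM Hu (topM Hb Hg)))))
  (topN (topM Hu (topM Hu (topM Hb Hd))))) (topN (topM Hp (topM Hb (topM Hb Hb)))))
  (topN (topW (topM H2 (topM Hu (topM Hu (topM Ha Hg)))))))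
  (topM Hu (topM Ha (topM Hb Hb))).
have HR := topD (topD (topD (topW (topM Hrho Hrho)) (topW (topM Hsig Htau)))
  (topM HX HE)) (topM (topM (topM HX HX) (topM Hu (topM Hu Hu))) Hg).
have [|t] := top_root HR.
  by apply: contraNneq e0 => E; apply/eqP; rewrite -[RHS]E /e; ring.
rewrite !(hornerD, hornerN, hornerM, hornerC, hornerX, horner_Poly) /= => Et.
have [w [Ef Eh]] := common_root p00 Et.
exists t, 1, w; rewrite oner_eq0 orbT; split=> //.
apply/singE; rewrite /quad; split.
- by rewrite -[RHS]Eh; ring.
- have := congr2 (fun i j => w * i + t * j) Ef Eh.
  by rewrite /= !mulr0 addr0; apply: etrans; ring.
- by rewrite -[RHS]Ef; ring.
Qed.

(** If (0:0:1) is not singular, a swap or a shear makes y = 0 tangent to the foliation there, so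
    that [exists_sing] applies. *)
Lemma every_good v : good (om v).
Proof.
have tangent_good (w : vf K) : cq0 w = 0 -> cp0 w != 0 -> good (om w).
  move=> q00 p00; have [a [b [c [sw ab]]]] := exists_sing q00 p00.
  exact: sing_good sw ab.
have [p00|p00] := eqVneq (cp0 v) 0.
  have [q00|q00] := eqVneq (cq0 v) 0; first exact: vertex_good.
  apply/good_swapxy/tangent_good; case: v p00 q00 => /= *; subst; rewrite ?oppr0 //.
  by rewrite oppr_eq0.
apply: (good_shear (t := cq0 v / cp0 v)); apply: tangent_good; case: v p00 => //= *.
by rewrite mulrC divfK // subrr.
Qed.

End EveryFoliation.

(** * Every foliation of degree 2 has the coordinate form *)

Section Parametrization.
Variable K : numClosedFieldType.
Local Notation x := ('X_i0 : {mpoly K[3]}).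
Local Notation y := ('X_i1 : {mpoly K[3]}).
Local Notation z := ('X_i2 : {mpoly K[3]}).
Implicit Types (p : {mpoly K[3]}).

Lemma homog0_const p : p \is 0.-homog -> exists c, p = c%:MP.
Proof.
move=> hp; exists p@_0; apply/mpolyP => m; rewrite mcoeffC.
have [->|m0] := eqVneq m 0%MM; first by rewrite mulr1.
by rewrite mulr0 (dhomog_nemf_coeff hp) //= mdeg_eq0.
Qed.

(** Euler's identity divided by [d.+1] gives the three cofactors as multiples of the partial
    derivatives. *)
Lemma homogS_split d p : p \is d.+1.-homog ->
  exists q0 q1 q2, [/\ q0 \is d.-homog, q1 \is d.-homog, q2 \is d.-homog &
    p = x * q0 + y * q1 + z * q2].
Proof.
move=> hp; pose c : {mpoly K[3]} := (d.+1%:R^-1)%:MP.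
have hc i : c * p^`M(i) \is d.-homog.
  by rewrite mul_mpolyC; apply/dhomogZ/(dhomog_mderiv i hp).
exists (c * p^`M(i0)), (c * p^`M(i1)), (c * p^`M(i2)); split=> //.
have := euler_homog hp; rewrite sum3 => /(congr1 ( *%R c)) E.
transitivity (c * (d.+1%:R * p)); last by rewrite -E; ring.
by rewrite mulrA /c -mpolyC_nat -mpolyCM mulVf ?pnatr_eq0 // mpolyC1 mul1r.
Qed.

Lemma homog1_expand p : p \is 1.-homog ->
  exists a b c, p = a%:MP * x + b%:MP * y + c%:MP * z.
Proof.
case/homogS_split => ? [? [? [/homog0_const[a ->] /homog0_const[b ->]]]].
by case/homog0_const => c -> ->; exists a, b, c; ring.
Qed.

Lemma homog2_expand p : p \is 2.-homog ->
  exists a0 a1 a2 a3 a4 a5,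
  p = quad a0%:MP a1%:MP a2%:MP a3%:MP a4%:MP a5%:MP x y z.
Proof.
case/homogS_split => ? [? [? [/homog1_expand[a [b [c ->]]]]]].
case/homog1_expand => a' [b' [c' ->]] /homog1_expand[a'' [b'' [c'' ->]]] ->.
by exists c'', (c + a''), (c' + b''), a, (b + a'), b'; rewrite /quad; ring.
Qed.

Lemma homog3_expand p : p \is 3.-homog ->
  exists a0 a1 a2 a3 a4 a5 b0 b1 b2 b3,
  p = z * quad a0%:MP a1%:MP a2%:MP a3%:MP a4%:MP a5%:MP x y z
    + b0%:MP * x ^+ 3 + b1%:MP * x ^+ 2 * y + b2%:MP * x * y ^+ 2 + b3%:MP * y ^+ 3.
Proof.
case/homogS_split => ? [? [? [/homog2_expand[a0 [a1 [a2 [a3 [a4 [a5 ->]]]]]]]]].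
case/homog2_expand => b0 [b1 [b2 [b3 [b4 [b5 ->]]]]].
case/homog2_expand => c0 [c1 [c2 [c3 [c4 [c5 ->]]]]] ->.
exists c0, (c1 + a0), (c2 + b0), (c3 + a1), (c4 + a2 + b1), (c5 + b2).
by exists a3, (a4 + b3), (a5 + b4), b5; rewrite /quad; ring.
Qed.

(** On z = 0 the Euler relation forces the first two coefficients to be y g and - x g; the third is
    recovered from the relation by cancelling z. *)
Lemma om_surjective (w : mtriple K) :
  homog_triple 3 w -> euler_zero w -> exists v, w = om v.
Proof.
move=> hw ew.
have [q0 [q1 [q2 [q3 [q4 [q5 [a0 [a1 [a2 [a3 EA]]]]]]]]]] := homog3_expand (hw i0).
have [p0 [p1 [p2 [p3 [p4 [p5 [b0 [b1 [b2 [b3 EB]]]]]]]]]] := homog3_expand (hw i1).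
have E := ew; rewrite /euler_zero sum3 EA EB in E.
(* The Euler relation on z = 0; its values at (1,0), (0,1), (1,1), (1,-1) and (1,2) make all five
   coefficients vanish. *)
have H s t : a0 * s ^+ 4 + (a1 + b0) * s ^+ 3 * t + (a2 + b1) * s ^+ 2 * t ^+ 2 +
    (a3 + b2) * s * t ^+ 3 + b3 * t ^+ 4 = 0.
  have := congr1 (meval (pt s t 0)) E.
  rewrite /quad !(rmorphD, rmorphM, rmorphXn, rmorph0) /= !mevalXU !mevalC /pt /=.
  by apply: etrans; ring.
have a00 : a0 = 0 by rewrite -[RHS](H 1 0); ring.
have b30 : b3 = 0 by rewrite -[RHS](H 0 1); ring.
have r2 : a2 + b1 = 0.
  have := congr2 +%R (H 1 1) (H 1 (-1)); rewrite a00 b30 addr0 => E2.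
  have /eqP : (a2 + b1) *+ 2 = 0 by rewrite -[RHS]E2; ring.
  by rewrite mulrn_eq0 => /eqP.
have E1 : a1 + b0 + (a3 + b2) = 0.
  have := H 1 1; rewrite a00 b30 r2 => E1; rewrite -[RHS]E1; ring.
have r3 : a3 + b2 = 0.
  have := H 1 2%:R; rewrite a00 b30 r2 (_ : a1 + b0 = - (a3 + b2)); last first.
    by apply/eqP; rewrite -addr_eq0 E1.
  move=> E3; have /eqP : (a3 + b2) *+ 6 = 0 by rewrite -[RHS]E3; ring.
  by rewrite mulrn_eq0 => /eqP.
have r1 : a1 + b0 = 0 by rewrite -[RHS]E1 r3 addr0.
exists (VF (- p0) (- p1) (- p2) (- p3) (- p4) (- p5) q0 q1 q2 q3 q4 q5 a1 a2 a3).
have z0 : z != 0 by exact: mpolyXU_neq0.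
have Eb : [/\ b0 = - a1, b1 = - a2 & b2 = - a3].
  by split; apply/eqP; rewrite -addr_eq0 addrC; apply/eqP.
case: Eb => Eb0 Eb1 Eb2.
apply: eq_from_tnth; apply: forall3; rewrite tnth_mktuple /form /=.
- by rewrite EA a00 /quad; ring.
- by rewrite EB b30 Eb0 Eb1 Eb2 /quad; ring.
apply: (mulfI z0); apply/eqP; rewrite -subr_eq0 -[X in _ == X]E.
by rewrite a00 b30 Eb0 Eb1 Eb2 /quad -subr_eq0; apply/eqP; ring.
Qed.

End Parametrization.

Lemma foliation2_pullback (K : numClosedFieldType) (F : foliation K 2) :
  exists psi : ratmap K 2,
    birational psi /\
    exists (e : nat) (G : foliation K e), is_pullback psi F G /\ (e <= 3)%N.
Proof.
have [v Ev] := om_surjective (@fol_homog _ _ F) (@fol_euler _ _ F).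
have := every_good (v := v); rewrite -Ev => /(_ (@fol_reduced _ _ F)).
case=> psi [bpsi [e [G [h [h0 gh Eh le_e3]]]]].
by exists psi; split=> //; exists e, G; split=> //; exists h.
Qed.

Theorem theorem1 (R : realType) (F : foliation R[i] 2) :
  exists psi : ratmap R[i] 2,
    birational psi /\
    exists (e : nat) (G : foliation R[i] e),
      is_pullback psi F G /\ (e <= 3)%N.
Proof. exact: foliation2_pullback. Qed.
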